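(* Let $X$ be any topological space and $\alpha\in H_2(X)$. Then $$2\,\operatorname{gen}(\alpha)\geq \operatorname{rank}(\alpha\cap -),$$ where $\alpha\cap-\colon H^1(X)\to H_1(X)$ is the cap product map and its rank is the rank of its image.
   Context: (Co)homology is integral. A closed oriented (possibly disconnected) surface $\Sigma$ represents a class $\alpha\in H_2(X)$ if there is a continuous map $f\colon\Sigma\to X$ with $f_*([\Sigma])=\alpha$, where $[\Sigma]$ is the fundamental class. The genus of a disconnected surface is the sum of the genera of its components. The minimal genus $\operatorname{gen}(\alpha)$ is the minimum of the genera of surfaces representing $\alpha$. *)

(* Defs.v *)
From HB Require Import structures.
From Stdlib Require Import Relation_Operators.
From mathcomp Require Import all_boot all_order all_algebra.
From mathcomp Require Import generic_quotient ring_quotient.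
From mathcomp Require Import all_classical all_reals all_analysis.
From mathcomp Require Import freeg zify.

Set Implicit Arguments.
Unset Strict Implicit.
Unset Printing Implicit Defensive.
Import Order.TTheory GRing.Theory Num.Theory.
Import numFieldNormedType.Exports.
Local Open Scope classical_set_scope.
Local Open Scope ring_scope.

(* The subquotient Z / (Z \cap B) of an abelian group V. *)
Section Subquotient.
Variables (V : zmodType) (Z B : zmodClosed V).

Definition subgrp : Type := {x : V | x \in Z}.
HB.instance Definition _ := SubChoice.on subgrp.
HB.instance Definition _ := [SubChoice_isSubZmodule of subgrp by <:].

Definition in_denom : {pred subgrp} := [pred x | val x \in B].

Lemma in_denom_zmod_closed : zmod_closed in_denom.
Proof.
split=> [|x y xB yB]; rewrite inE; first by rewrite GRing.val0 rpred0.
by rewrite GRing.valB rpredB.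
Qed.
HB.instance Definition _ :=
  GRing.isZmodClosed.Build subgrp in_denom in_denom_zmod_closed.

Definition subquot : Type := Quotient.quot in_denom.
HB.instance Definition _ := GRing.Zmodule.on subquot.

Definition subquot_class (x : V) (xZ : x \in Z) : subquot :=
  \pi_(Quotient.quot in_denom)%qT (exist _ x xZ).
Definition subquot_rep (a : subquot) : V :=
  val (repr (a : Quotient.quot in_denom)).

Lemma subquot_rep_in (a : subquot) : subquot_rep a \in Z.
Proof. exact: valP. Qed.

Lemma subquot_class_eq (x y : V) (xZ : x \in Z) (yZ : y \in Z) :
  subquot_class xZ = subquot_class yZ <-> x - y \in B.
Proof.
pose x' : subgrp := exist _ x xZ; pose y' : subgrp := exist _ y yZ.
have <- : x' - y' \in in_denom = (x - y \in B) by rewrite inE GRing.valB.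
by rewrite Quotient.idealrBE; split=> /eqP.
Qed.

Lemma subquot_repK (a : subquot) : subquot_class (subquot_rep_in a) = a.
Proof.
rewrite -[RHS](@reprK _ (Quotient.quot in_denom)) /subquot_class; congr (\pi%qT _).
exact: val_inj.
Qed.

Lemma subquot_rep_class (x : V) (xZ : x \in Z) : subquot_rep (subquot_class xZ) - x \in B.
Proof. by apply/(subquot_class_eq (subquot_rep_in _) xZ); rewrite subquot_repK. Qed.
End Subquotient.
Arguments subquot_class {V} Z B {x} xZ.

Section SingularChains.
Variable R : realType.

Definition std_simplex (n : nat) : set 'rV[R]_n.+1 :=
  [set x | (forall i, 0 <= x 0 i) /\ \sum_i x 0 i = 1].
Arguments std_simplex : clear implicits.

(* The affine map Delta^m -> Delta^n sending the vertex i to the vertex f i. *)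
Section Affine.
Variables (m n : nat) (f : 'I_m.+1 -> 'I_n.+1).

Definition affine_row (x : 'rV[R]_m.+1) : 'rV[R]_n.+1 :=
  \row_j \sum_(i | f i == j) x 0 i.

Lemma affine_row_in (x : std_simplex m) : affine_row (val x) \in std_simplex n.
Proof.
have [x0 x1] := set_valP x; apply/mem_set; split=> [j|].
  by rewrite mxE sumr_ge0.
rewrite -x1 [RHS](partition_big f xpredT) //=.
by apply: eq_bigr => j _; rewrite mxE.
Qed.

Definition affine (x : std_simplex m) : std_simplex n :=
  exist _ (affine_row (val x)) (affine_row_in x).

Lemma affine_row_continuous : continuous affine_row.
Proof.
move=> x B [P xP sPB].
have cf j : continuous (fun y : 'rV[R]_m.+1 => \sum_(k | f k == j) y 0 k).
  apply: continuous_big => [|k _]; first exact: add_continuous.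
  exact: coord_continuous.
have : \forall y \near x, forall j, P 0 j (affine_row y 0 j).
  apply: (@filter_forall _ _ (fun j y => P 0 j (affine_row y 0 j)) (nbhs x) _) => j.
  have /cf : nbhs (\sum_(k | f k == j) x 0 k) (P 0 j).
    by have := xP 0 j; rewrite mxE.
  by apply: (@filterS _ (nbhs x) _) => y; rewrite /= mxE.
by apply: (@filterS _ (nbhs x) _) => y yP; apply: sPB => i j; rewrite ord1; exact: yP.
Qed.

Lemma affine_continuous : continuous affine.
Proof.
apply: continuous_comp_initial => x.
apply: (@continuous_comp _ _ _ set_val affine_row).
  exact: initial_continuous.
exact: affine_row_continuous.
Qed.
HB.instance Definition _ := isContinuous.Build _ _ affine affine_continuous.
End Affine.

Lemma affine_comp m n p (g : 'I_n.+1 -> 'I_p.+1) (f : 'I_m.+1 -> 'I_n.+1) :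
  affine g \o affine f = affine (g \o f).
Proof.
apply/funext => x; apply: val_inj; apply/rowP => j /=; rewrite !mxE.
rewrite [RHS](partition_big f (fun i => g i == j)) //=.
apply: eq_bigr => i /eqP gij; rewrite mxE; apply: eq_bigl => k.
by case: (f k =P i) => [->|]; rewrite ?gij ?eqxx ?andbF.
Qed.

Section Space.
Variable X : topologicalType.
Implicit Types n : nat.

Definition simplex n := continuousType (std_simplex n) X.
Definition chain n := {freeg (simplex n) / int}.
Definition cochain n := simplex n -> int.

Definition reindex m n (f : 'I_m.+1 -> 'I_n.+1) (s : simplex n) : simplex m :=
  s \o affine f.

Lemma reindex_comp m n p (g : 'I_n.+1 -> 'I_p.+1) (f : 'I_m.+1 -> 'I_n.+1) s :
  reindex f (reindex g s) = reindex (g \o f) s.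
Proof. by apply/continuousEP => x; rewrite /= -affine_comp. Qed.

Definition face n (i : 'I_n.+2) : simplex n.+1 -> simplex n := reindex (fintype.lift i).

Definition boundary n : chain n -> chain n.-1 :=
  match n with
  | 0 => fun=> 0
  | n'.+1 => fglift (fun s : simplex n'.+1 =>
      \sum_(i < n'.+2) << (-1) ^+ i *g face i s >>)
  end.

Definition coboundary n (phi : cochain n) : cochain n.+1 :=
  fun s => \sum_(i < n.+2) (-1) ^+ i * phi (face i s).

(* For n = k + l, front k s and back l s are the restrictions of s to the     *)
(* faces [v_0, ..., v_k] and [v_k, ..., v_n].                                 *)
Definition front k n (s : simplex n) : simplex k :=
  reindex (fun i : 'I_k.+1 => inord i) s.
Definition back l n (s : simplex n) : simplex l :=
  reindex (fun i : 'I_l.+1 => inord (n - l + i)) s.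

(* Meaningful only for n = k + l; a free n avoids casts between equal degrees. *)
Definition cap_chain k l n (c : chain n) (phi : cochain k) : chain l :=
  fglift (fun s : simplex n => << phi (front k s) *g back l s >>) c.

Lemma boundaryB n : zmod_morphism (@boundary n).
Proof. by case: n => [x y|n] /=; [rewrite subr0 | exact: lift_is_additive]. Qed.
HB.instance Definition _ n :=
  GRing.isZmodMorphism.Build (chain n) (chain n.-1) (@boundary n) (@boundaryB n).

Lemma coboundaryB n : zmod_morphism (@coboundary n).
Proof.
move=> f g; apply/funext => s; rewrite /coboundary.
rewrite -[RHS]/(_ - _) -sumrB; apply: eq_bigr => i _.
by rewrite -mulrBr.
Qed.
HB.instance Definition _ n :=
  GRing.isZmodMorphism.Build (cochain n) (cochain n.+1) (@coboundary n)
    (@coboundaryB n).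

Definition cycles n : {pred chain n} := [pred c | boundary c == 0].
Definition boundaries n : {pred chain n} :=
  [pred c | `[< exists e : chain n.+1, c = boundary e >]].
Definition cocycles n : {pred cochain n} := [pred phi | coboundary phi == 0].
Definition coboundaries n : {pred cochain n} :=
  match n with
  | 0 => [pred phi | phi == 0]
  | n'.+1 => [pred phi | `[< exists psi : cochain n', phi = coboundary psi >]]
  end.

Definition chains_in (A : set X) n : {pred chain n} :=
  [pred c | all (fun s : simplex n => `[< range s `<=` A >]) (dom c)].
Definition rel_cycles (A : set X) n : {pred chain n} :=
  [pred c | boundary c \in chains_in A (n := n.-1)].
Definition rel_boundaries (A : set X) n : {pred chain n} :=
  [pred c | `[< exists e : chain n.+1, c - boundary e \in chains_in A (n := n) >]].

Lemma cycles_zmod_closed n : zmod_closed (@cycles n).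
Proof.
split=> [|x y]; first by apply/eqP; rewrite raddf0.
by move=> /eqP dx /eqP dy; apply/eqP; rewrite raddfB /= dx dy subr0.
Qed.
HB.instance Definition _ n :=
  GRing.isZmodClosed.Build (chain n) (@cycles n) (@cycles_zmod_closed n).

Lemma boundaries_zmod_closed n : zmod_closed (@boundaries n).
Proof.
split=> [|x y]; first by apply/asboolP; exists 0; rewrite raddf0.
move=> /asboolP[e ->] /asboolP[e' ->]; apply/asboolP; exists (e - e').
by rewrite raddfB.
Qed.
HB.instance Definition _ n :=
  GRing.isZmodClosed.Build (chain n) (@boundaries n) (@boundaries_zmod_closed n).

Lemma cocycles_zmod_closed n : zmod_closed (@cocycles n).
Proof.
split=> [|x y]; first by apply/eqP; rewrite raddf0.
by move=> /eqP dx /eqP dy; apply/eqP; rewrite raddfB /= dx dy subr0.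
Qed.
HB.instance Definition _ n :=
  GRing.isZmodClosed.Build (cochain n) (@cocycles n) (@cocycles_zmod_closed n).

Lemma coboundaries_zmod_closed n : zmod_closed (@coboundaries n).
Proof.
case: n => [|n]; split=> [|x y].
- exact: eqxx.
- by move=> /eqP-> /eqP->; rewrite subr0; exact: eqxx.
- by apply/asboolP; exists 0; rewrite raddf0.
move=> /asboolP[e ->] /asboolP[e' ->]; apply/asboolP; exists (e - e').
by rewrite raddfB.
Qed.
HB.instance Definition _ n :=
  GRing.isZmodClosed.Build (cochain n) (@coboundaries n)
    (@coboundaries_zmod_closed n).

Lemma chains_in_zmod_closed A n : zmod_closed (@chains_in A n).
Proof.
split=> [|x y].
  by rewrite inE dom0.
move=> /allP xA /allP yA; apply/allP => s /domB.
by rewrite mem_cat => /orP[/xA|/yA].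
Qed.
HB.instance Definition _ A n :=
  GRing.isZmodClosed.Build (chain n) (@chains_in A n) (@chains_in_zmod_closed A n).

Lemma rel_cycles_zmod_closed A n : zmod_closed (@rel_cycles A n).
Proof.
have [A0 AB] := chains_in_zmod_closed A n.-1.
split=> [|x y].
  by rewrite inE raddf0.
by rewrite ![_ \in rel_cycles _ (n:=_)]inE raddfB; exact: AB.
Qed.
HB.instance Definition _ A n :=
  GRing.isZmodClosed.Build (chain n) (@rel_cycles A n)
    (@rel_cycles_zmod_closed A n).

Lemma rel_boundaries_zmod_closed A n : zmod_closed (@rel_boundaries A n).
Proof.
split=> [|x y].
  by apply/asboolP; exists 0; rewrite raddf0 subr0 rpred0.
move=> /asboolP[e xe] /asboolP[e' ye']; apply/asboolP; exists (e - e').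
suff -> : x - y - boundary (e - e') = (x - boundary e) - (y - boundary e').
  exact: rpredB.
rewrite boundaryB; move: (boundary e) (boundary e') => be be'.
by rewrite !opprB [be' - be]addrC [be' - y]addrC addrACA.
Qed.
HB.instance Definition _ A n :=
  GRing.isZmodClosed.Build (chain n) (@rel_boundaries A n)
    (@rel_boundaries_zmod_closed A n).

Definition homology n := subquot (@cycles n) (@boundaries n).
Definition cohomology n := subquot (@cocycles n) (@coboundaries n).
Definition rel_homology A n := subquot (@rel_cycles A n) (@rel_boundaries A n).
End Space.
End SingularChains.
Arguments std_simplex : clear implicits.
Arguments chains_in : clear implicits.
Arguments cycles : clear implicits.
Arguments boundaries : clear implicits.
Arguments cocycles : clear implicits.
Arguments coboundaries : clear implicits.
Arguments rel_cycles : clear implicits.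
Arguments rel_boundaries : clear implicits.

Section ChainMaps.
Variable R : realType.

Lemma chain_additive_eq (K : choiceType) (V : zmodType)
    (F G : {freeg K / int} -> V) :
  zmod_morphism F -> zmod_morphism G ->
  (forall s, F << s >> = G << s >>) -> F =1 G.
Proof.
move=> FB GB FG c.
pose F' := GRing.isZmodMorphism.Build _ _ F FB.
pose G' := GRing.isZmodMorphism.Build _ _ G GB.
pose HF : {additive {freeg K / int} -> V} := HB.pack F F'.
pose HG : {additive {freeg K / int} -> V} := HB.pack G G'.
rewrite -[F]/(HF : _ -> _) -[G]/(HG : _ -> _).
elim/freeg_ind_dom0: c => [|k s c _ _ IH]; first by rewrite !raddf0.
have -> : << k *g s >> = << s >> *~ k :> {freeg K / int}.
  by rewrite freegU_mulz intz.
by rewrite !raddfD !raddfMz IH /= FG.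
Qed.

Lemma subBACA (V : zmodType) (a b c d : V) : a - b - (c - d) = a - c - (b - d).
Proof. by rewrite !opprB [d - c]addrC [d - b]addrC addrACA. Qed.

Lemma freegUZ (K : choiceType) (c k : int) (s : K) :
  c *: << k *g s >> = << (c * k) *g s >> :> {freeg K / int}.
Proof. by apply/eqP/freeg_eqP => t; rewrite coeffZ !coeffU mulrA. Qed.

Lemma freegUB1 (K : choiceType) (s : K) :
  zmod_morphism (fun k : int => << k *g s >> : {freeg K / int}).
Proof. by move=> a b; rewrite freegUB. Qed.

Section Pushforward.
Variables (X Y : topologicalType) (f : continuousType X Y).

Definition push_chain n : chain R X n -> chain R Y n :=
  fglift (fun s : simplex R X n => << (f \o s : simplex R Y n) >>).

Lemma push_chainB n : zmod_morphism (@push_chain n).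
Proof. exact: lift_is_additive. Qed.
HB.instance Definition _ n :=
  GRing.isZmodMorphism.Build _ _ (@push_chain n) (@push_chainB n).

Lemma push_chainU n (s : simplex R X n) (k : int) :
  push_chain << k *g s >> = << k *g (f \o s : simplex R Y n) >>.
Proof. by rewrite /push_chain liftU freegUZ mulr1. Qed.

Lemma push_boundary n (c : chain R X n) :
  push_chain (boundary c) = boundary (push_chain c).
Proof.
case: n c => [|n] c; first by rewrite raddf0.
pose F (c : chain R X n.+1) := push_chain (boundary c).
pose G (c : chain R X n.+1) := boundary (push_chain c).
apply: (@chain_additive_eq _ _ F G) => [a b|a b|s]; rewrite /F /G ?raddfB //.
rewrite push_chainU /= !liftU !scale1r raddf_sum; apply: eq_bigr => i _.
by rewrite -[LHS]/(push_chain _) push_chainU; congr << _ *g _ >>; apply/continuousEP.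
Qed.
End Pushforward.

Section Cap.
Variable X : topologicalType.
Implicit Types k l n : nat.

Lemma cap_chainU k l n (a : int) (s : simplex R X n) (phi : cochain R X k) :
  cap_chain l << a *g s >> phi = << (a * phi (front k s)) *g back l s >>.
Proof. by rewrite /cap_chain liftU freegUZ. Qed.

Lemma cap_chainBl k l n (phi : cochain R X k) :
  zmod_morphism (fun c : chain R X n => cap_chain l c phi : chain R X l).
Proof. exact: lift_is_additive. Qed.

Lemma cap_chainBr k l n (c : chain R X n) :
  zmod_morphism (fun phi : cochain R X k => cap_chain l c phi : chain R X l).
Proof.
move=> phi psi.
pose F (c : chain R X n) : chain R X l := cap_chain l c (phi - psi).
pose G (c : chain R X n) : chain R X l := cap_chain l c phi - cap_chain l c psi.
apply: (@chain_additive_eq _ _ F G) => [a b|a b|s]; rewrite /F /G.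
- exact: cap_chainBl.
- by rewrite !cap_chainBl; apply: subBACA.
- by rewrite !cap_chainU freegUB !mul1r.
Qed.

Section Faces.
Variables (k l n : nat) (n_kl : n = (k + l)%N) (s : simplex R X n.+1).

Let reindex_ext m (f g : 'I_m.+1 -> 'I_n.+2) :
  (forall x, f x = g x :> nat) -> reindex f s = reindex g s.
Proof.
by move=> fg; have -> : f = g by apply/funext => x; apply/val_inj/fg.
Qed.

Lemma front_face_le i : (i <= k)%N ->
  front k (face (inord i) s) = face (inord i) (front k.+1 s).
Proof.
move=> ik; rewrite /front /face !reindex_comp; apply: reindex_ext => x /=.
by have xlt := ltn_ord x; rewrite /= !inordK /bump; lia.
Qed.

Lemma back_face_le i : (i <= k)%N -> back l (face (inord i) s) = back l s.
Proof.
move=> ik; rewrite /back /face !reindex_comp; apply: reindex_ext => x /=.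
by have xlt := ltn_ord x; rewrite /= !inordK /bump; lia.
Qed.

Lemma front_face_gt j : (j <= l)%N ->
  front k (face (inord (k.+1 + j)) s) = front k s.
Proof.
move=> jl; rewrite /front /face !reindex_comp; apply: reindex_ext => x /=.
by have xlt := ltn_ord x; rewrite /= !inordK /bump; lia.
Qed.

Lemma back_face_gt j : (j <= l)%N ->
  back l (face (inord (k.+1 + j)) s) = face (inord j.+1) (back l.+1 s).
Proof.
move=> jl; rewrite /back /face !reindex_comp; apply: reindex_ext => x /=.
by have xlt := ltn_ord x; rewrite /= !inordK /bump; lia.
Qed.

Lemma face_front_last : face (inord k.+1) (front k.+1 s) = front k s.
Proof.
rewrite /front /face !reindex_comp; apply: reindex_ext => x /=.
by have xlt := ltn_ord x; rewrite /= !inordK /bump; lia.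
Qed.

Lemma face_back_first : face (inord 0) (back l.+1 s) = back l s.
Proof.
rewrite /back /face !reindex_comp; apply: reindex_ext => x /=.
by have xlt := ltn_ord x; rewrite /= !inordK /bump; lia.
Qed.
End Faces.

Lemma cap_chain_sum k l n (I : Type) (r : seq I) (F : I -> chain R X n)
    (phi : cochain R X k) :
  cap_chain l (\sum_(i <- r) F i) phi = \sum_(i <- r) cap_chain l (F i) phi.
Proof.
pose G' := GRing.isZmodMorphism.Build _ _ _ (@cap_chainBl k l n phi).
pose G : {additive chain R X n -> chain R X l} := HB.pack (fun c => cap_chain l c phi) G'.
exact: (raddf_sum G).
Qed.

Lemma sum_inord (V : zmodType) m (F : 'I_m.+1 -> V) :
  \sum_(i < m.+1) F i = \sum_(0 <= i < m.+1) F (inord i).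
Proof. by rewrite big_mkord; apply: eq_bigr => i _; rewrite inord_val. Qed.

Lemma freegU_sum (K : choiceType) (I : Type) (r : seq I) (F : I -> int) (s : K) :
  << \sum_(i <- r) F i *g s >> = \sum_(i <- r) << F i *g s >> :> {freeg K / int}.
Proof.
pose G' := GRing.isZmodMorphism.Build _ _ _ (freegUB1 s).
pose G : {additive int -> {freeg K / int}} := HB.pack (fun k : int => << k *g s >>) G'.
exact: (raddf_sum G).
Qed.

Lemma boundary_cap k l n (c : chain R X n.+1) (phi : cochain R X k) :
  n = (k + l)%N ->
  boundary (cap_chain l.+1 c phi) = (-1) ^+ k *:
    (cap_chain l (boundary c) phi - cap_chain l c (coboundary phi)).
Proof.
move=> nkl.
pose F (c : chain R X n.+1) := boundary (cap_chain l.+1 c phi).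
pose G (c : chain R X n.+1) : chain R X l := (-1) ^+ k *:
    (cap_chain l (boundary c : chain R X n) phi - cap_chain l c (coboundary phi)).
apply: (@chain_additive_eq _ _ F G) => [a b|a b|s]; rewrite /F /G.
- by rewrite cap_chainBl raddfB.
- rewrite boundaryB !cap_chainBl. rewrite -scalerBr; congr (_ *: _); exact: subBACA.
rewrite !cap_chainU mul1r /= !liftU scale1r.
rewrite mul1r cap_chain_sum /coboundary freegU_sum scaler_sumr !sum_inord.
have nE : n.+2 = (k.+1 + l.+1)%N by lia.
pose T i := << ((-1) ^+ i * phi (face (inord i) (front k.+1 s))) *g back l s >>
  : chain R X l.
pose U j := << ((-1) ^+ j * phi (front k s)) *g face (inord j) (back l.+1 s) >>
  : chain R X l.
have -> : \sum_(0 <= i < n.+2)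
    cap_chain l << (-1) ^+ (inord i : 'I_n.+2) *g face (inord i) s >> phi =
    \sum_(0 <= i < k.+1) T i + (-1) ^+ k *: \sum_(0 <= j < l.+1) U j.+1.
  have lE : (n.+2 - k.+1 = l.+1)%N by rewrite nE addKn.
  have kn : (k.+1 <= n.+2)%N by rewrite nE leq_addr.
  rewrite (big_cat_nat (leq0n k.+1) kn) /=.
  rewrite -{2}[k.+1]add0n big_addn lE scaler_sumr.
  congr (_ + _); apply: eq_big_nat => i /andP[_ ilt]; rewrite cap_chainU inordK; try lia.
    by rewrite (front_face_le nkl) // (back_face_le nkl).
  rewrite [(i + _)%N]addnC (front_face_gt nkl) // (back_face_gt nkl) // freegUZ.
  by rewrite mulrA -exprD addSnnS.
have -> : \sum_(0 <= i < k.+2)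
    << ((-1) ^+ (inord i : 'I_k.+2) * phi (face (inord i) (front k.+1 s))) *g back l s >> =
    \sum_(0 <= i < k.+1) T i - (-1) ^+ k *: U 0%N.
  rewrite big_nat_recr //=; congr (_ + _).
    by apply: eq_big_nat => i /andP[_ ilt]; rewrite inordK //; lia.
  rewrite inordK // (face_front_last nkl) /U (face_back_first nkl).
  by rewrite freegUZ freegUN expr0 mul1r exprS mulN1r mulNr.
rewrite opprD opprK addrACA subrr add0r -scalerDr scalerA -expr2 sqrr_sign scale1r.
rewrite addrC big_nat_recl // inordK // freegUZ mulrC; congr (_ + _).
by apply: eq_big_nat => i /andP[_ ilt]; rewrite inordK // freegUZ mulrC.
Qed.

End Cap.
End ChainMaps.

Section InducedMaps.
Variables (R : realType) (X : topologicalType).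

Section Functoriality.
Variables (Y : topologicalType) (f : continuousType X Y) (n : nat).

Lemma push_cycles (c : chain R X n) :
  c \in cycles R X n -> push_chain f c \in cycles R Y n.
Proof.
by move=> /eqP c0; apply/eqP; rewrite -push_boundary c0 raddf0.
Qed.

Definition push (a : homology R X n) : homology R Y n :=
  subquot_class (cycles R Y n) (boundaries R Y n)
    (push_cycles (subquot_rep_in a)).

Lemma push_class (c : chain R X n) (cZ : c \in cycles R X n) :
  push (subquot_class (cycles R X n) (boundaries R X n) cZ) =
  subquot_class (cycles R Y n) (boundaries R Y n) (push_cycles cZ).
Proof.
apply/subquot_class_eq; rewrite -push_chainB.
have /asboolP[e ->] := subquot_rep_class (boundaries R X n) cZ.
by apply/asboolP; exists (push_chain f e); rewrite -push_boundary.
Qed.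
End Functoriality.

Section RelativeClass.
Variables (A : set X) (n : nat).

Lemma cycles_rel (c : chain R X n) :
  c \in cycles R X n -> c \in rel_cycles R X A n.
Proof. by move=> /eqP c0; rewrite inE c0 rpred0. Qed.

Definition to_rel (a : homology R X n) : rel_homology R A n :=
  subquot_class (rel_cycles R X A n) (rel_boundaries R X A n)
    (cycles_rel (subquot_rep_in a)).

Lemma to_rel_class (c : chain R X n) (cZ : c \in cycles R X n) :
  to_rel (subquot_class (cycles R X n) (boundaries R X n) cZ) =
  subquot_class (rel_cycles R X A n) (rel_boundaries R X A n) (cycles_rel cZ).
Proof.
apply/subquot_class_eq.
have /asboolP[e ->] := subquot_rep_class (boundaries R X n) cZ.
by apply/asboolP; exists e; rewrite subrr rpred0.
Qed.
End RelativeClass.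

Section CapProduct.
Variables k l : nat.

Lemma cap_chain0l n (phi : cochain R X k) :
  cap_chain l (0 : chain R X n) phi = 0.
Proof. by have := cap_chainBl l phi (0 : chain R X n) 0; rewrite !subrr. Qed.

Lemma cap_chain0r n (c : chain R X n) :
  cap_chain l c (0 : cochain R X k) = 0.
Proof. by have := cap_chainBr l c (0 : cochain R X k) 0; rewrite !subrr. Qed.
End CapProduct.

Lemma cap_cycles k l n (c : chain R X n) (phi : cochain R X k) :
  n = (k + l)%N -> c \in cycles R X n -> phi \in cocycles R X k ->
  cap_chain l c phi \in cycles R X l.
Proof.
move=> nE /eqP c0 /eqP phi0; apply/eqP.
case: l nE => [//|l]; rewrite addnS; case: n c c0 => [//|n] c c0 [nE].
by rewrite boundary_cap // c0 phi0 cap_chain0l cap_chain0r subrr scaler0.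
Qed.

Lemma cap_boundaries k l n (c : chain R X n) (phi : cochain R X k) :
  n = (k + l)%N -> c \in boundaries R X n -> phi \in cocycles R X k ->
  cap_chain l c phi \in boundaries R X l.
Proof.
move=> nE /asboolP[e ->] /eqP phi0; apply/asboolP.
exists ((-1) ^+ k *: cap_chain l.+1 e phi).
have -> : boundary ((-1) ^+ k *: cap_chain l.+1 e phi) =
    (-1) ^+ k *: boundary (cap_chain l.+1 e phi).
  by rewrite -signr_odd; case: (odd k); rewrite ?scale1r // !scaleN1r raddfN.
by rewrite boundary_cap // phi0 cap_chain0r subr0 scalerA -expr2 sqrr_sign scale1r.
Qed.

Lemma cap_coboundaries k l n (c : chain R X n) (phi : cochain R X k) :
  n = (k + l)%N -> c \in cycles R X n -> phi \in coboundaries R X k ->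
  cap_chain l c phi \in boundaries R X l.
Proof.
case: k phi => [|k] phi nE /eqP c0.
  by move=> /eqP ->; rewrite cap_chain0r rpred0.
move=> /asboolP[psi ->]; apply/asboolP.
case: n c nE c0 => [//|n] c [nE] c0.
exists ((-1) ^+ k.+1 *: cap_chain l.+1 c psi).
have -> : boundary ((-1) ^+ k.+1 *: cap_chain l.+1 c psi) =
    (-1) ^+ k.+1 *: boundary (cap_chain l.+1 c psi).
  by rewrite -signr_odd; case: (odd k.+1); rewrite ?scale1r // !scaleN1r raddfN.
rewrite boundary_cap // c0 cap_chain0l sub0r scalerN exprS mulN1r scaleNr.
by rewrite scalerN opprK scalerA -expr2 sqrr_sign scale1r.
Qed.

Section CapProduct.
Variables k l : nat.

Definition cap (a : homology R X (k + l)) (b : cohomology R X k) :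
    homology R X l :=
  subquot_class (cycles R X l) (boundaries R X l)
    (cap_cycles (erefl (k + l)%N) (subquot_rep_in a) (subquot_rep_in b)).

Lemma cap_class (c : chain R X (k + l)) (phi : cochain R X k)
    (cZ : c \in cycles R X (k + l)) (phiZ : phi \in cocycles R X k) :
  cap (subquot_class (cycles R X (k + l)) (boundaries R X (k + l)) cZ)
      (subquot_class (cocycles R X k) (coboundaries R X k) phiZ) =
  subquot_class (cycles R X l) (boundaries R X l)
    (cap_cycles (erefl (k + l)%N) cZ phiZ).
Proof.
apply/subquot_class_eq.
set c' := subquot_rep _; set phi' := subquot_rep _.
have c'B : c' - c \in boundaries R X (k + l) by exact: subquot_rep_class.
have phi'B : phi' - phi \in coboundaries R X k by exact: subquot_rep_class.
have phi'Z : phi' \in cocycles R X k by exact: subquot_rep_in.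
rewrite -[_ - _](subrKA (cap_chain l c phi')) -cap_chainBl -cap_chainBr.
apply: rpredD; first exact: cap_boundaries.
exact: cap_coboundaries.
Qed.
End CapProduct.
End InducedMaps.

(* The maximal number of Z-linearly independent elements of the subgroup A,   *)
(* +oo if this number is unbounded.                                           *)
Section Rank.
Variables (R : realType) (V : zmodType).

Definition Zfree (k : nat) (v : 'I_k -> V) : Prop :=
  forall c : 'I_k -> int, \sum_i v i *~ c i = 0 -> forall i, c i = 0.

Definition zrank (A : set V) : \bar R :=
  ereal_sup [set (k%:R)%:E | k in
    [set k : nat | exists2 v : 'I_k -> V, (forall i, A (v i)) & Zfree v]].
End Rank.

Definition homeomorphic (S T : topologicalType) : Prop :=
  exists (f : S -> T) (g : T -> S),
    [/\ continuous f, continuous g, cancel f g & cancel g f].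

Section Surfaces.
Variable R : realType.

Definition locally_planar (S : topologicalType) : Prop :=
  forall x : S, exists (U : set S) (V : set (R * R)),
    [/\ open U, U x, open V & homeomorphic U V].

(* A compact locally Euclidean Hausdorff space is second countable. *)
Definition closed_surface (S : topologicalType) : Prop :=
  [/\ hausdorff_space S, compact [set: S] & locally_planar S].

(* A class of H_2(S) whose image generates H_2(S, S \ x) (an infinite cyclic  *)
(* group) for every x: this is the same thing as an orientation of S, of      *)
(* which it is the fundamental class.                                         *)
Definition fundamental_class (S : topologicalType) (mu : homology R S 2) :=
  forall (x : S) (b : rel_homology R (~` [set x]) 2),
    exists m : int, b = to_rel (~` [set x]) mu *~ m.

(* The standard surface of genus g: the sphere for g = 0 and, for g > 0, the  *)
(* closed disc whose boundary circle is divided into 4g arcs glued according  *)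
(* to the word a_0 b_0 a_0^-1 b_0^-1 ... a_(g-1) b_(g-1) a_(g-1)^-1 b_(g-1)^-1. *)
Definition sphere : set 'rV[R]_3 := [set x | \sum_i x 0 i ^+ 2 = 1].

Definition disc : set (R * R) := [set p | p.1 ^+ 2 + p.2 ^+ 2 <= 1].

Section Polygon.
Variable g : nat.

(* The point at parameter s \in [0, 1] of the k-th arc. *)
Definition arc (k : nat) (s : R) : R * R :=
  let t := 2 * pi * (k%:R + s) / (4 * g)%N%:R in (cos t, sin t).

Definition glued (p q : disc) : Prop :=
  exists (j : nat) (s : R), [/\ (j < g)%N, 0 <= s <= 1 &
       val p = arc (4 * j) s /\ val q = arc (4 * j + 2) (1 - s)
    \/ val p = arc (4 * j + 1) s /\ val q = arc (4 * j + 3) (1 - s)].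

Definition glue_equiv (p q : disc) : bool :=
  `[< clos_refl_sym_trans disc glued p q >].

Lemma glue_equiv_is_equiv : equiv_class_of glue_equiv.
Proof.
split=> [p|p q|q p r].
- by apply/asboolP; exact: rst_refl.
- by apply/asboolP/asboolP; exact: rst_sym.
- by move=> /asboolP pq /asboolP qr; apply/asboolP; exact: rst_trans pq qr.
Qed.
Canonical glue_equiv_equiv := EquivRelPack glue_equiv_is_equiv.

Definition glued_disc : topologicalType :=
  quotient_topology {eq_quot glue_equiv}%qT.
End Polygon.

Definition standard_surface (g : nat) : topologicalType :=
  match g with
  | 0 => sphere
  | g'.+1 => glued_disc g'.+1
  end.

Definition components (S : topologicalType) : set (set S) :=
  range (connected_component [set: S]).
Arguments components : clear implicits.

Definition has_genus (S : topologicalType) (g : nat) : Prop :=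
  exists gamma : set S -> nat,
    [/\ finite_set (components S),
        forall C, components S C -> homeomorphic C (standard_surface (gamma C))
      & g = \sum_(C \in components S) gamma C].

Definition genera (X : topologicalType) (alpha : homology R X 2) : set nat :=
  [set g | exists (S : topologicalType) (mu : homology R S 2)
             (f : continuousType S X),
     [/\ closed_surface S, fundamental_class mu, push f mu = alpha
       & has_genus S g]].

(* An infimum of natural numbers, hence a minimum; +oo if there are none. *)
Definition gen (X : topologicalType) (alpha : homology R X 2) : \bar R :=
  ereal_inf [set (g%:R)%:E | g in genera alpha].
End Surfaces.

(* Main.v *)
Require Import Defs.
From mathcomp Require Import all_boot all_order all_algebra.
From mathcomp Require Import all_classical all_reals all_analysis.
From HB Require Import structures.
From Stdlib Require Import Relation_Operators.
From mathcomp Require Import generic_quotient ring_quotient.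
From mathcomp Require Import finmap freeg ring lra zify.

Set Implicit Arguments.
Unset Strict Implicit.
Unset Printing Implicit Defensive.
Import Order.TTheory GRing.Theory Num.Theory.
Import numFieldNormedType.Exports.
Local Open Scope classical_set_scope.
Local Open Scope ring_scope.

(** Let f : S -> X represent alpha, with S of genus g.  The cap product is
natural, alpha cap b = f_*([S] cap f^*b), so that alpha cap b vanishes as soon
as f^*b does, and the rank of (alpha cap -) is at most the rank of H^1(S).  It remains to see
that H^1(S) has rank at most 2g.

For this, 2g paths in S are exhibited such that a 1-cocycle on S whose
values on these paths are all zero is a coboundary ([surface_detected]).  The
values of k > 2g cocycles on the 2g paths then satisfy a nontrivial integer
relation ([int_relation]), and the same relation holds between their classes,
hence between their cap products with alpha.

A cocycle phi is treated as a closed form: it has an integral [period phi gamma]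
along every path gamma.  Splitting a square into two triangles shows that this
integral is invariant under homotopies in the manner of Green's formula
([period_square]); so the pull-back of phi to the plane by any continuous map Q
is exact, with primitive the integral over segments from the origin
([period_cone]).

A component of S is the image of the closed disc under some q: the gluing map of
the 4g-gon, or the map that collapses the boundary circle to the north pole.
The pull-back of phi to the disc has a primitive, and if phi vanishes on the 2g
edges this primitive takes the same value at points with the same image
([glued_disc_detected], [sphere_detected]); so it is h o q for a function h.
A path in S need not lift to the disc, not even locally, so that a further
argument is needed to see that phi integrates to the increments of h along every
path ([period_descent]).  Around a point x of the surface, phi has a local
primitive h_N on a neighbourhood N, by the planar charts.  As q is a closed map, all
points y close to x are images of points p close to the fibre of x, and the
segment from the fibre to p is mapped into N.  Comparing the two primitives on
this liftable path gives h_N(y) - h_N(x) = h(y) - h(x).  The two primitives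
differ locally by a constant, and the real line is connected. *)

(** * Continuity of explicit maps *)

Section Continuity.
Variables (R : realType) (T : topologicalType).
Implicit Types f g : T -> R.

Lemma cts_add f g : continuous f -> continuous g -> continuous (fun x => f x + g x).
Proof. by move=> cf cg x; apply: cvgD; [exact: cf|exact: cg]. Qed.

Lemma cts_opp f : continuous f -> continuous (fun x => - f x).
Proof. by move=> cf x; apply: cvgN; exact: cf. Qed.

Lemma cts_mul f g : continuous f -> continuous g -> continuous (fun x => f x * g x).
Proof. by move=> cf cg x; apply: cvgM; [exact: cf|exact: cg]. Qed.

Lemma cts_exp f n : continuous f -> continuous (fun x => f x ^+ n).
Proof.
move=> cf x; apply: (@continuous_comp _ _ _ f (fun y => y ^+ n)); first exact: cf.
exact: exprn_continuous.
Qed.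

Lemma cts_inv f :
  continuous f -> (forall x, f x != 0) -> continuous (fun x => (f x)^-1).
Proof. by move=> cf f0 x; apply: cvgV => //; exact: cf. Qed.

Lemma cts_max f g : continuous f -> continuous g ->
  continuous (fun x => Num.max (f x) (g x)).
Proof. by move=> cf cg x; apply: continuous_max; [exact: cf|exact: cg]. Qed.

Lemma cts_min f g : continuous f -> continuous g ->
  continuous (fun x => Num.min (f x) (g x)).
Proof. by move=> cf cg x; apply: continuous_min; [exact: cf|exact: cg]. Qed.

Lemma cts_sqrt f : continuous f -> continuous (fun x => Num.sqrt (f x)).
Proof. by move=> cf x; apply: continuous_comp; [exact: cf|exact: sqrt_continuous]. Qed.

Lemma cts_cos f : continuous f -> continuous (fun x => cos (f x)).
Proof. by move=> cf x; apply: continuous_comp; [exact: cf|exact: continuous_cos]. Qed.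

Lemma cts_sin f : continuous f -> continuous (fun x => sin (f x)).
Proof. by move=> cf x; apply: continuous_comp; [exact: cf|exact: continuous_sin]. Qed.

Lemma cts_cst (U : topologicalType) (c : U) : continuous (fun _ : T => c).
Proof. by move=> x; exact: cvg_cst. Qed.

Lemma cts_id : continuous (fun x : T => x).
Proof. by move=> x; exact: cvg_id. Qed.

Lemma cts_pair (U V : topologicalType) (f : T -> U) (g : T -> V) :
  continuous f -> continuous g -> continuous (fun x => (f x, g x)).
Proof. by move=> cf cg x; exact: (cvg_pair (cf x) (cg x)). Qed.

Lemma cts_fst (U V : topologicalType) (f : T -> U * V) :
  continuous f -> continuous (fun x => (f x).1).
Proof. by move=> cf x; apply: continuous_comp; [exact: cf|exact: cvg_fst]. Qed.

Lemma cts_snd (U V : topologicalType) (f : T -> U * V) :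
  continuous f -> continuous (fun x => (f x).2).
Proof. by move=> cf x; apply: continuous_comp; [exact: cf|exact: cvg_snd]. Qed.

Lemma cts_comp (U V : topologicalType) (g : U -> V) (f : T -> U) :
  continuous g -> continuous f -> continuous (fun x => g (f x)).
Proof. by move=> cg cf x; apply: continuous_comp; [exact: cf|exact: cg]. Qed.

Lemma cts_row n (f : T -> 'rV[R]_n) :
  (forall j, continuous (fun x => f x 0 j)) -> continuous f.
Proof.
move=> cf x B [P xP sPB].
have : \forall y \near x, forall j, P 0 j (f y 0 j).
  apply: (@filter_forall _ _ (fun j y => P 0 j (f y 0 j)) (nbhs x) _) => j.
  exact: cf.
apply: (@filterS _ (nbhs x) _) => y yP; apply: sPB => i j.
by rewrite ord1; exact: yP.
Qed.
End Continuity.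

(** Dispatching on the outermost operation keeps unification from unfolding the
arithmetic of R.  Higher-order unification produces eta-reduced functions,
whence the clauses for partially applied operations. *)
Ltac cts := repeat (first [ assumption | lazymatch goal with
  | |- forall y, continuous_at y (fun _ => ?c) => apply: cts_cst
  | |- forall y, continuous_at y (fun x => x) => apply: cts_id
  | |- forall y, continuous_at y (fun x => (@?f x) + (@?g x)) => apply: cts_add
  | |- forall y, continuous_at y (fun x => (@?f x) * (@?g x)) => apply: cts_mul
  | |- forall y, continuous_at y (fun x => (@?f x) ^+ _) => apply: cts_exp
  | |- forall y, continuous_at y (fun x => - (@?f x)) => apply: cts_opp
  | |- forall y, continuous_at y (fun x => Num.max (@?f x) (@?g x)) => apply: cts_max
  | |- forall y, continuous_at y (fun x => Num.min (@?f x) (@?g x)) => apply: cts_min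
  | |- forall y, continuous_at y (fun x => Num.sqrt (@?f x)) => apply: cts_sqrt
  | |- forall y, continuous_at y (fun x => cos (@?f x)) => apply: cts_cos
  | |- forall y, continuous_at y (fun x => sin (@?f x)) => apply: cts_sin
  | |- forall y, continuous_at y (fun x => (@?f x, @?g x)) => apply: cts_pair
  | |- forall y, continuous_at y (fun x => (@?f x).1) => apply: cts_fst
  | |- forall y, continuous_at y (fun x => (@?f x).2) => apply: cts_snd
  | |- forall y, continuous_at y -%R => apply: (@cts_opp _ _ (fun x => x))
  | |- forall y, continuous_at y (pair ?a) =>
      apply: (@cts_pair _ _ _ (fun=> a) (fun x => x))
  | |- forall y, continuous_at y (+%R ?a) =>
      apply: (@cts_add _ _ (fun=> a) (fun x => x))
  | |- forall y, continuous_at y ( *%R ?a) =>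
      apply: (@cts_mul _ _ (fun=> a) (fun x => x))
  | |- forall y, continuous_at y fst => apply: (@cts_fst _ _ _ (fun x => x))
  | |- forall y, continuous_at y snd => apply: (@cts_snd _ _ _ (fun x => x))
  end]).

(** * Periods of 1-cochains along paths *)

Section Clamp.
Variable R : realType.

(** The retraction of the line onto the unit interval; it turns paths that are
only meaningful on the interval into continuous maps on the whole line. *)
Definition clamp (t : R) : R := Num.max 0 (Num.min t 1).

Lemma clamp01 t : 0 <= clamp t <= 1.
Proof. by rewrite /clamp le_max lexx ge_max ler01 ge_min lexx orbT. Qed.

Lemma clamp_id t : 0 <= t <= 1 -> clamp t = t.
Proof. by move=> /andP[t0 t1]; rewrite /clamp min_l // max_r. Qed.

Lemma clamp_cts : continuous clamp.
Proof. rewrite /clamp; cts. Qed.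

Lemma segment_coord (x : std_simplex R 1) :
  0 <= val x 0 ord_max <= 1 /\ val x 0 ord0 = 1 - val x 0 ord_max.
Proof.
have [x0 x1] := set_valP x.
move: x1; rewrite !big_ord_recr big_ord0 /= add0r => x1.
have := x0 ord0; have := x0 ord_max.
have -> : ord0 = widen_ord (leqnSn 1) ord_max by apply: val_inj.
rewrite /=; lra.
Qed.

Definition segment_row (t : R) : 'rV[R]_2 :=
  \row_j (if j == ord_max then clamp t else 1 - clamp t).

Lemma segment_row_in t : segment_row t \in std_simplex R 1.
Proof.
apply/mem_set; have /andP[t0 t1] := clamp01 t; split=> [i|].
  by rewrite mxE; case: ifP => _; lra.
by rewrite !big_ord_recr big_ord0 /= !mxE /=; lra.
Qed.

Definition segment_point t : std_simplex R 1 :=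
  exist _ (segment_row t) (segment_row_in t).

Lemma segment_point_cts : continuous segment_point.
Proof.
apply: continuous_comp_initial; apply: cts_row => j.
have cF : continuous (fun t : R => if j == ord_max then clamp t else 1 - clamp t).
  by have cc := clamp_cts; case: (j == ord_max); cts.
suff E : (fun t => if j == ord_max then clamp t else 1 - clamp t) =
    (fun x => (set_val \o segment_point) x 0 j) by move: cF; rewrite E.
by apply/funext => t; rewrite -[RHS]/(segment_row t 0 j) mxE.
Qed.

Lemma vertex_row_in : const_mx 1 \in std_simplex R 0.
Proof. by apply/mem_set; split=> [i|]; rewrite ?big_ord1 mxE. Qed.

Definition vertex_point : std_simplex R 0 := exist _ (const_mx 1) vertex_row_in.

Lemma vertex_pointE (x : std_simplex R 0) : x = vertex_point.
Proof.
apply: val_inj; apply/rowP => i.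
by have [_] := set_valP x; rewrite big_ord1 !ord1 mxE.
Qed.
End Clamp.

Section Periods.
Variables (R : realType) (S : topologicalType).
Implicit Types (phi : cochain R S 1) (gamma : R -> S).

Definition path_simplex gamma (c : continuous gamma) : simplex R S 1 :=
  mkcts c \o (mkcts (@coord_continuous R 1 2 0 ord_max) \o
     mkcts (@initial_continuous (std_simplex R 1 : Type) 'rV[R]_2 set_val)).

Lemma path_simplexE gamma (c : continuous gamma) x :
  path_simplex c x = gamma (val x 0 ord_max).
Proof. by []. Qed.

(** The path is gamma on the unit interval.  Taking a bare function, with the
junk value 0 if it is not continuous, lets paths be rewritten
without transporting proofs of continuity. *)
Definition period phi gamma : int :=
  if pselect (continuous gamma) is left c then phi (path_simplex c) else 0.

Lemma periodE phi gamma (c : continuous gamma) :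
  period phi gamma = phi (path_simplex c).
Proof.
by rewrite /period; case: pselect => // c'; congr phi; apply/continuousEP.
Qed.

Lemma eq_period phi gamma gamma' : continuous gamma -> continuous gamma' ->
  (forall t, 0 <= t <= 1 -> gamma t = gamma' t) -> period phi gamma = period phi gamma'.
Proof.
move=> c c' e; rewrite (periodE phi c) (periodE phi c'); congr phi.
by apply/continuousEP => x; rewrite !path_simplexE e // (segment_coord x).1.
Qed.

Definition path_of (s : simplex R S 1) (t : R) : S := s (segment_point t).

Lemma path_of_cts s : continuous (path_of s).
Proof. apply: cts_comp; [exact: cts_fun|exact: segment_point_cts]. Qed.

Lemma period_path_of phi s : period phi (path_of s) = phi s.
Proof.
rewrite (periodE phi (@path_of_cts s)); congr phi; apply/continuousEP => x.
rewrite path_simplexE /path_of; congr (s _); apply: val_inj; apply/rowP => j.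
have [c e] := segment_coord x; rewrite /= mxE clamp_id //.
case: (unliftP ord_max j) => [k ->|-> //].
have -> : fintype.lift ord_max k = ord0 by apply: val_inj; rewrite ord1.
exact: esym.
Qed.

Definition vertex_simplex (x : S) : simplex R S 0 := cst x.

Lemma vertex_simplexE (s : simplex R S 0) : s = vertex_simplex (s (vertex_point R)).
Proof. by apply/continuousEP => y; rewrite /= [y]vertex_pointE. Qed.

Lemma coboundary_vertexE (psi : cochain R S 0) (s : simplex R S 1) :
  coboundary psi s =
    psi (vertex_simplex (path_of s 1)) - psi (vertex_simplex (path_of s 0)).
Proof.
rewrite /coboundary !big_ord_recr big_ord0 /= add0r expr0 mul1r expr1 mulN1r.
congr (psi _ - psi _); rewrite [LHS]vertex_simplexE; congr vertex_simplex;
  rewrite /path_of /=; congr (s _); apply: val_inj; apply/rowP => j;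
  rewrite /= !mxE big_mkcond big_ord1 mxE clamp_id ?ler01 ?lexx // ?subrr ?subr0;
  by case: j => [[|[|//]] ?]; rewrite -val_eqE /=.
Qed.

Lemma triangle_coord_cts :
  continuous (fun x : 'rV[R]_3 => (x 0 (fintype.lift ord0 ord0), x 0 ord_max)).
Proof. by apply: cts_pair; exact: coord_continuous. Qed.

Definition triangle_simplex (F : R * R -> S) (c : continuous F) : simplex R S 2 :=
  mkcts c \o (mkcts triangle_coord_cts \o
    mkcts (@initial_continuous (std_simplex R 2 : Type) 'rV[R]_3 set_val)).

(** The cocycle condition on the triangle with vertices (0,0), (1,0), (0,1). *)
Lemma period_triangle phi (F : R * R -> S) :
  phi \in cocycles R S 1 -> continuous F ->
  period phi (fun t => F (t, 0)) + period phi (fun t => F (1 - t, t)) =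
  period phi (fun t => F (0, t)).
Proof.
move=> /eqP phi0 c.
have c1 : continuous (fun t : R => F (t, 0)) by apply: (cts_comp c); cts.
have c2 : continuous (fun t : R => F (1 - t, t)) by apply: (cts_comp c); cts.
have c3 : continuous (fun t : R => F (0, t)) by apply: (cts_comp c); cts.
rewrite (periodE _ c1) (periodE _ c2) (periodE _ c3).
have := congr1 (fun f => f (triangle_simplex c)) phi0.
rewrite /coboundary !big_ord_recr big_ord0 /= add0r.
rewrite expr0 mul1r expr1 mulN1r sqrrN expr1n mul1r.
set f0 := face _ _; set f1 := face _ _; set f2 := face _ _.
have -> : f0 = path_simplex c2.
  apply/continuousEP => x; rewrite path_simplexE.
  pose i0 : 'I_3 := widen_ord (leqnSn _) (widen_ord (leqnSn _) ord_max).
  pose y := affine_row (fintype.lift i0) (val x).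
  rewrite -[LHS]/(F (y 0 (fintype.lift ord0 ord0), y 0 ord_max)) /y !mxE.
  have [_ <-] := segment_coord x; congr (F (_, _)).
    by rewrite (big_pred1 ord0) // => i; rewrite -val_eqE; case: i => [[|[|//]] ?].
  by rewrite (big_pred1 ord_max) // => i; rewrite -val_eqE; case: i => [[|[|//]] ?].
have -> : f1 = path_simplex c3.
  apply/continuousEP => x; rewrite path_simplexE.
  pose y := affine_row (fintype.lift (widen_ord (leqnSn 2) ord_max)) (val x).
  rewrite -[LHS]/(F (y 0 (fintype.lift ord0 ord0), y 0 ord_max)) /y !mxE.
  congr (F (_, _)).
    by rewrite big_pred0 // => i; rewrite -val_eqE; case: i => [[|[|//]] ?].
  by rewrite (big_pred1 ord_max) // => i; rewrite -val_eqE; case: i => [[|[|//]] ?].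
have -> : f2 = path_simplex c1.
  apply/continuousEP => x; rewrite path_simplexE.
  pose y := affine_row (fintype.lift ord_max) (val x).
  rewrite -[LHS]/(F (y 0 (fintype.lift ord0 ord0), y 0 ord_max)) /y !mxE.
  congr (F (_, _)).
    by rewrite (big_pred1 ord_max) // => i; rewrite -val_eqE; case: i => [[|[|//]] ?].
  by rewrite big_pred0 // => i; rewrite -val_eqE; case: i => [[|[|//]] ?].
rewrite -[(0 : cochain R S 2) _]/(0 : int) => E.
apply/eqP; rewrite -subr_eq0; apply/eqP; rewrite -[RHS]E; ring.
Qed.

Lemma period_cst phi x : phi \in cocycles R S 1 -> period phi (fun=> x) = 0.
Proof.
move=> phiZ; have := @period_triangle phi (fun=> x) phiZ (@cts_cst _ _ x).
by rewrite -[RHS]addr0 => /addrI.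
Qed.

Lemma period_add phi gamma a b c : phi \in cocycles R S 1 -> continuous gamma ->
  period phi (fun t => gamma (a + t * (b - a))) +
  period phi (fun t => gamma (b + t * (c - b))) =
  period phi (fun t => gamma (a + t * (c - a))).
Proof.
move=> phiZ cg.
(* the triangle is mapped affinely to the line, its vertices to a, b and c *)
have := @period_triangle phi (fun p => gamma (a + p.1 * (b - a) + p.2 * (c - a))) phiZ.
have -> : (fun t : R => gamma (a + (t, 0 : R).1 * (b - a) + (t, 0 : R).2 * (c - a))) =
    fun t => gamma (a + t * (b - a)).
  by apply/funext => t /=; rewrite mul0r addr0.
have -> : (fun t : R => gamma (a + (1 - t, t).1 * (b - a) + (1 - t, t).2 * (c - a))) =
    fun t => gamma (b + t * (c - b)).
  by apply/funext => t /=; congr gamma; ring.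
have -> : (fun t : R => gamma (a + (0 : R, t).1 * (b - a) + (0 : R, t).2 * (c - a))) =
    fun t => gamma (a + t * (c - a)).
  by apply/funext => t /=; congr gamma; ring.
apply; apply: (cts_comp cg); cts.
Qed.

(** Green's formula: the diagonal splits the square into two triangles. *)
Lemma period_square phi (H : R * R -> S) : phi \in cocycles R S 1 -> continuous H ->
  period phi (fun t => H (t, 0)) + period phi (fun t => H (1, t)) =
  period phi (fun t => H (0, t)) + period phi (fun t => H (t, 1)).
Proof.
move=> phiZ cH.
have := @period_triangle phi (fun p => H (p.1 + p.2, p.2)) phiZ.
have := @period_triangle phi (fun p => H (p.2, p.1 + p.2)) phiZ.
rewrite /=.
have -> : (fun t : R => H (0 + t, t)) = (fun t => H (t, t)).
  by apply/funext => t; rewrite add0r.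
have -> : (fun t : R => H (t, 0 + t)) = (fun t => H (t, t)).
  by apply/funext => t; rewrite add0r.
have -> : (fun t : R => H (t + 0, 0)) = (fun t => H (t, 0)).
  by apply/funext => t; rewrite addr0.
have -> : (fun t : R => H (0, t + 0)) = (fun t => H (0, t)).
  by apply/funext => t; rewrite addr0.
have -> : (fun t : R => H (t, 1 - t + t)) = (fun t => H (t, 1)).
  by apply/funext => t; rewrite subrK.
have -> : (fun t : R => H (1 - t + t, t)) = (fun t => H (1, t)).
  by apply/funext => t; rewrite subrK.
by move=> -> //; [move=> -> //|]; apply: (cts_comp cH); cts.
Qed.

Definition cone_period phi (Q : R * R -> S) (p : R * R) : int :=
  period phi (fun t => Q (t * p.1, t * p.2)).

(** The plane is contractible, so that the pull-back of a cocycle by Q is exact: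
apply Green's formula to the cone (s, t) |-> Q (s gamma(t)), one side of which is
a constant path. *)
Lemma period_cone phi (Q : R * R -> S) (gamma : R -> R * R) :
  phi \in cocycles R S 1 -> continuous Q -> continuous gamma ->
  period phi (fun t => Q (gamma t)) =
    cone_period phi Q (gamma 1) - cone_period phi Q (gamma 0).
Proof.
move=> phiZ cQ cg.
have := @period_square phi
  (fun p => Q (p.1 * (gamma p.2).1, p.1 * (gamma p.2).2)) phiZ.
have cg2 : continuous (fun p : R * R => gamma p.2) by apply: (cts_comp cg); cts.
rewrite /= /cone_period.
have -> : (fun t : R => Q (1 * (gamma t).1, 1 * (gamma t).2)) = (fun t => Q (gamma t)).
  by apply/funext => t; rewrite !mul1r -surjective_pairing.
have -> : (fun t : R => Q (0 * (gamma t).1, 0 * (gamma t).2)) = (fun=> Q (0, 0)).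
  by apply/funext => t; rewrite !mul0r.
rewrite period_cst // add0r => <-; first by rewrite addrAC subrr add0r.
by apply: (cts_comp cQ); cts.
Qed.
End Periods.

(** * Local primitives and descent along a closed map *)

Section Descent.
Variables (R : realType) (S : topologicalType).

(** Viewed as a real function, k is differentiable with derivative 0. *)
Lemma locally_constant_eq (k : R -> int) a b :
  (forall x, \forall y \near x, k y = k x) -> k a = k b.
Proof.
move=> kloc; apply/eqP; rewrite -(eqr_int R); apply/eqP.
apply: (@is_derive_0_is_cst _ (fun x => (k x)%:~R : R)) => x.
apply: (@near_eq_is_derive _ _ _ (cst ((k x)%:~R : R)) _ x 1 0).
by apply: filterS (kloc x) => y /= ->.
Qed.

Lemma near_segment (t0 : R) (P : set R) : nbhs t0 P ->
  \forall b \near t0, forall t, 0 <= t <= 1 -> P (t0 + t * (b - t0)).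
Proof.
move=> /nbhs_ballP[e e0 eP]; near=> b => t /andP[t0' t1].
apply: eP; rewrite -ball_normE /= opprD addrA subrr sub0r normrN normrM ger0_norm //.
have : `|b - t0| < e.
  by near: b; apply/nbhs_normP; exists e => // y /=; rewrite distrC.
by apply: le_lt_trans; rewrite ler_piMl.
Unshelve. all: by end_near. Qed.

(** The chart is inverted on the whole plane, by retracting the plane onto a
square inside the range of the chart; so cones in the chart need no domain. *)
Lemma planar_chart (x : S) : locally_planar R S ->
  exists (Q : R * R -> S) (e : S -> R * R) (N : set S),
    [/\ continuous Q, nbhs x N &
        forall y, N y -> Q (e y) = y /\ {for y, continuous e}].
Proof.
move=> /(_ x)[U [V [oU Ux oV [f [g [cf cg fK gK]]]]]].
pose u0 : U := exist _ x (mem_set Ux).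
pose v0 : R * R := set_val (f u0).
have Vv0 : V v0 by exact: set_valP.
have [d d0 dV] : exists2 d : R, 0 < d & ball v0 d `<=` V.
  by have /nbhs_ballP[d d0 dV] := open_nbhs_nbhs (conj oV Vv0); exists d.
pose cl (c y : R) : R := Num.max (c - d / 2) (Num.min y (c + d / 2)).
pose rho (p : R * R) := (cl v0.1 p.1, cl v0.2 p.2).
have cl_near c y : `|c - cl c y| < d.
  rewrite ltr_norml /cl; apply/andP.
  by split; rewrite /Num.max /Num.min; do 2 case: ifP; lra.
have rhoV p : rho p \in V by apply/mem_set/dV; split=> /=; exact: cl_near.
pose Q (p : R * R) : S := set_val (g (exist _ (rho p) (rhoV p))).
pose e (y : S) : R * R := if pselect (U y) is left Uy
  then set_val (f (exist _ y (mem_set Uy))) else v0.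
have eE y (Uy : U y) : e y = set_val (f (exist _ y (mem_set Uy))).
  rewrite /e; case: pselect => // Uy'; congr (set_val (f _)); exact: val_inj.
have ce y : U y -> {for y, continuous e}.
  move=> Uy A; rewrite (eE _ Uy) => nA.
  have cf' : continuous (set_val \o f : U -> R * R).
    by apply: (cts_comp (@initial_continuous _ _ _)).
  have /= := cf' (exist _ y (mem_set Uy)) A nA.
  move=> [B [[W oW WB] By BA]].
  have Wy : W y by move: By; rewrite -WB.
  have : nbhs y (W `&` U) by apply: open_nbhs_nbhs; split=> //; apply: openI.
  apply: filterS => z [Wz Uz]; rewrite /= (eE _ Uz); apply: BA.
  by rewrite -WB.
exists Q, e, (U `&` e @^-1` (ball v0 (d / 2))); split.
- apply: (cts_comp (@initial_continuous _ _ _)); apply: (cts_comp cg).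
  apply: continuous_comp_initial.
  suff : continuous rho by [].
  by rewrite /rho /cl; cts.
- apply: filterI; first exact: open_nbhs_nbhs.
  apply: (ce _ Ux); rewrite (eE _ Ux).
  have -> : f (exist _ x (mem_set Ux)) = f u0 by [].
  by apply: nbhsx_ballx; rewrite divr_gt0.
- move=> y [Uy ye]; split; last exact: ce.
  have re : rho (e y) = e y.
    move: ye => []; rewrite /ball /= /rho => h1 h2.
    have cl_id c z : `|c - z| < d / 2 -> cl c z = z.
      by rewrite ltr_norml => /andP[? ?]; rewrite /cl min_l ?max_r //; lra.
    by rewrite !cl_id // -surjective_pairing.
  rewrite /Q.
  have -> : exist _ (rho (e y)) (rhoV (e y)) = f (exist _ y (mem_set Uy)) :> V.
    by apply: val_inj; rewrite /= re (eE _ Uy).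
  by rewrite fK.
Qed.

(** Paths in a chart lift to the plane, where every cocycle is exact. *)
Lemma period_local_primitive (phi : cochain R S 1) (x : S) :
  locally_planar R S -> phi \in cocycles R S 1 ->
  exists (N : set S) (h : S -> int), nbhs x N /\
    forall gamma : R -> S, continuous gamma ->
      (forall t, 0 <= t <= 1 -> N (gamma t)) ->
      period phi gamma = h (gamma 1) - h (gamma 0).
Proof.
move=> lS phiZ; have [Q [e [N [cQ xN Ne]]]] := planar_chart x lS.
exists N, (fun y => cone_period phi Q (e y)); split=> // gamma cg gN.
(* Outside the unit interval gamma may leave N, where e need not be continuous. *)
pose g' (t : R) := gamma (clamp t).
have cg' : continuous g' by apply: (cts_comp cg); exact: clamp_cts.
have g'N t : N (g' t) by apply/gN/clamp01.
have ceg : continuous (e \o g').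
  by move=> t; apply: continuous_comp; [exact: cg'|exact: (Ne _ (g'N t)).2].
have e1 : gamma 1 = g' 1 by rewrite /g' clamp_id // ler01 lexx.
have e0 : gamma 0 = g' 0 by rewrite /g' clamp_id // ler01 lexx.
rewrite e0 e1 -(@period_cone _ _ phi Q (e \o g') phiZ cQ ceg).
apply: eq_period => //; first by apply: (cts_comp cQ).
by move=> t t01; rewrite /= (Ne _ (g'N t)).1 /g' clamp_id.
Qed.

(** If h integrates phi along the paths that lift through Q, then it does so
along all paths in the range of Q, whether or not they lift.  Compactness of K
makes Q a closed map on K: a neighbourhood of the fibre over a point contains the
part in K of the preimage of a neighbourhood of this point. *)
Lemma period_descent (phi : cochain R S 1) (Q : R * R -> S) (K : set (R * R))
    (h : S -> int) :
  hausdorff_space S -> locally_planar R S -> phi \in cocycles R S 1 ->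
  continuous Q -> compact K -> range Q `<=` Q @` K ->
  (forall gamma : R -> R * R, continuous gamma ->
     period phi (Q \o gamma) = h (Q (gamma 1)) - h (Q (gamma 0))) ->
  forall gamma : R -> S, continuous gamma -> (forall t, range Q (gamma t)) ->
    period phi gamma = h (gamma 1) - h (gamma 0).
Proof.
move=> hS lS phiZ cQ cK QK hQ gamma cg gQ.
pose k (b : R) := period phi (fun t => gamma (0 + t * (b - 0))) - h (gamma b).
suff kloc : forall x, \forall y \near x, k y = k x.
  have := locally_constant_eq 1 0 kloc; rewrite /k.
  have -> : (fun t : R => gamma (0 + t * (1 - 0))) = gamma.
    by apply/funext => t; rewrite subr0 mulr1 add0r.
  have -> : (fun t : R => gamma (0 + t * (0 - 0))) = fun=> gamma 0.
    by apply/funext => t; rewrite subr0 mulr0 add0r.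
  by rewrite period_cst // => /eqP; rewrite subr_eq => /eqP ->; rewrite sub0r addrC.
move=> t0; have [N [hN [xN hNE]]] := period_local_primitive (gamma t0) lS phiZ.
(* the points joined to the fibre over x = gamma t0 by a segment mapped into N *)
pose O : set (R * R) := [set p | exists p0, Q p0 = gamma t0 /\
  forall t, 0 <= t <= 1 ->
    N (Q (p0.1 + t * (p.1 - p0.1), p0.2 + t * (p.2 - p0.2)))].
have OQ p0 : Q p0 = gamma t0 -> nbhs p0 O.
  move=> p0x; have : nbhs p0 (Q @^-1` N) by apply: cQ; rewrite p0x.
  move=> /nbhs_ballP[d d0 dN]; apply/nbhs_ballP; exists d => // p [p1 p2].
  exists p0; split=> // t /andP[t0' t1]; apply: dN; move: p1 p2; rewrite /ball /= => p1 p2.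
  split; rewrite /ball /= opprD addrA subrr sub0r normrN normrM ger0_norm // distrC;
    [move: p1|move: p2]; apply: le_lt_trans; rewrite ler_piMl //.
pose W := ~` (Q @` (K `&` ~` (interior O))).
have oW : open W.
  rewrite openC; apply: compact_closed => //; apply: continuous_compact.
    exact/continuous_subspaceT.
  apply: compact_closedI => //; exact/open_closedC/open_interior.
have Wx : W (gamma t0) by move=> [p [_ pO] px]; apply: pO; exact: OQ.
have nW : \forall b \near t0, W (gamma b) by apply: cg; apply: open_nbhs_nbhs.
have nN : \forall b \near t0, forall t, 0 <= t <= 1 -> N (gamma (t0 + t * (b - t0))).
  apply: (@near_segment t0 (gamma @^-1` N)); exact: cg.
near=> b.
have Nb : forall t, 0 <= t <= 1 -> N (gamma (t0 + t * (b - t0))) by near: b.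
have Wb : W (gamma b) by near: b.
have [p Kp pb] := QK _ (gQ b).
have [p0 [p0x segN]] : O p.
  have [//|pO] := pselect (O p); exfalso; apply: Wb; exists p => //.
  by split=> // /interior_subset.
have cgt : continuous (fun t : R => gamma (t0 + t * (b - t0))).
  by apply: (cts_comp cg); cts.
have E1 := hNE _ cgt Nb.
pose s (t : R) := (p0.1 + t * (p.1 - p0.1), p0.2 + t * (p.2 - p0.2)).
have cs : continuous s by rewrite /s; cts.
have E2 := hNE (Q \o s) (cts_comp cQ cs) segN.
have E3 := hQ s cs.
have s1 : s 1 = p.
  by rewrite /s !mul1r ![_ + (_ - _)]addrC !subrK -surjective_pairing.
have s0 : s 0 = p0 by rewrite /s !mul0r !addr0 -surjective_pairing.
move: E2; rewrite E3 /= s1 s0 p0x pb => E2.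
rewrite /k -(period_add 0 t0 b phiZ cg) E1 mul1r mul0r addr0 [t0 + _]addrC subrK.
rewrite -E2; ring.
Unshelve. all: by end_near. Qed.
End Descent.

(** * Images of the closed disc *)

Section DiscRetraction.
Variable R : realType.

(** Dividing by the square of the norm, not by the norm, still lands in the disc
and avoids square roots. *)
Definition disc_retract (p : R * R) : R * R :=
  let m := Num.max 1 (p.1 ^+ 2 + p.2 ^+ 2) in (p.1 / m, p.2 / m).

Lemma disc_retract_in p : disc (disc_retract p).
Proof.
rewrite /disc /disc_retract /= !expr_div_n -mulrDl.
set n := p.1 ^+ 2 + p.2 ^+ 2; set m := Num.max 1 n.
have m1 : 1 <= m by rewrite /m le_max lexx.
have nm : n <= m by rewrite /m le_max lexx orbT.
have m0 : 0 < m by lra.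
rewrite ler_pdivrMr ?exprn_gt0 // mul1r; apply: le_trans nm _.
by rewrite expr2 ler_peMr // ltW.
Qed.

Lemma disc_retract_id p : disc p -> disc_retract p = p.
Proof.
by rewrite /disc /disc_retract /= => pd; rewrite max_l // !divr1 -surjective_pairing.
Qed.

Lemma disc_retract_cts : continuous disc_retract.
Proof.
have cs : continuous (fun p : R * R => (Num.max 1 (p.1 ^+ 2 + p.2 ^+ 2))^-1).
  by apply: cts_inv => [|p]; [cts|rewrite gt_eqF // lt_max ltr01].
by rewrite /disc_retract /=; cts.
Qed.

Lemma disc_compact : compact (@disc R).
Proof.
have -> : @disc R = disc_retract @` (`[-1, 1] `*` `[-1, 1]).
  apply/seteqP; split=> [p pd|_ [p _ <-]]; last exact: disc_retract_in.
  exists p; last exact: disc_retract_id.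
  by move: pd; rewrite /disc /= => pd; split; rewrite /= in_itv /=; apply/andP; split; nra.
apply: continuous_compact; first exact/continuous_subspaceT/disc_retract_cts.
by apply: compact_setX; exact: segment_compact.
Qed.

Definition to_disc (p : R * R) : @disc R :=
  exist _ (disc_retract p) (mem_set (disc_retract_in p)).

Lemma to_disc_cts : continuous to_disc.
Proof. by apply: continuous_comp_initial; exact: disc_retract_cts. Qed.

Lemma to_discK (p : @disc R) : to_disc (val p) = p.
Proof. by apply: val_inj; rewrite /= disc_retract_id //; exact: set_valP. Qed.
End DiscRetraction.

Section Primitives.
Variables (R : realType) (S : topologicalType).

Definition has_primitive (C : set S) (phi : cochain R S 1) :=
  exists h : S -> int, forall gamma : R -> S, continuous gamma ->
    (forall t, C (gamma t)) -> period phi gamma = h (gamma 1) - h (gamma 0).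

Lemma has_primitive_sub (C D : set S) phi :
  C `<=` D -> has_primitive D phi -> has_primitive C phi.
Proof.
by move=> CD [h hE]; exists h => gamma cg gC; apply: hE => // t; exact: CD.
Qed.

(** Integration over the paths of es separates the cohomology classes of C, so
that the rank of H^1(C) is at most the size of es.  Cocycles, not classes, are
integrated: the paths of es may be open. *)
Definition detects (C : set S) (es : seq (R -> S)) :=
  forall phi : cochain R S 1, phi \in cocycles R S 1 ->
    all (fun e => period phi e == 0) es -> has_primitive C phi.

Lemma disc_image_primitive (phi : cochain R S 1) (q : @disc R -> S) :
  hausdorff_space S -> locally_planar R S ->
  phi \in cocycles R S 1 -> continuous q ->
  let Q := q \o @to_disc R in
  (forall p p', disc p -> disc p' -> Q p = Q p' ->
     cone_period phi Q p = cone_period phi Q p') ->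
  has_primitive (range q) phi.
Proof.
move=> hS lS phiZ cq Q compat.
have cQ : continuous Q by apply: (cts_comp cq); exact: to_disc_cts.
have Qr p : Q (disc_retract p) = Q p by congr q; exact: (to_discK (to_disc p)).
pose h y := cone_period phi Q (xget (0, 0) [set p | disc p /\ Q p = y]).
have hE p : disc p -> h (Q p) = cone_period phi Q p.
  move=> pd; rewrite /h; case: xgetP => [p' _ [p'd Qp']|/(_ p)[]]; last by split.
  exact: compat.
exists h => gamma cg gq.
apply: (period_descent hS lS phiZ cQ (@disc_compact R)) => //.
- move=> _ [p _ <-]; exists (disc_retract p); [exact: disc_retract_in|exact: Qr].
- move=> s cs; have csr : continuous (fun t => disc_retract (s t)).
    by apply: (cts_comp (@disc_retract_cts R)).
  have -> : Q \o s = (fun t => Q (disc_retract (s t))).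
    by apply/funext => t; rewrite /= Qr.
  rewrite (@period_cone _ _ phi Q _ phiZ cQ csr).
  by rewrite -[Q (s 1)]Qr -[Q (s 0)]Qr !hE //; exact: disc_retract_in.
- move=> t; have [p _ pt] := gq t; exists (val p) => //.
  by rewrite -pt /Q /= to_discK.
Qed.
End Primitives.

(** * Surfaces of positive genus *)

Local Notation arc := Defs.arc.

Section Arcs.
Variable R : realType.

Lemma arc_disc g k (s : R) : disc (arc g k s).
Proof. by rewrite /disc /arc /= cos2Dsin2. Qed.

Lemma arc_cts g k : continuous (@arc R g k).
Proof. by rewrite /Defs.arc /=; cts. Qed.

Lemma arc_next g k : arc g k (1 : R) = arc g k.+1 0.
Proof. by rewrite /arc addr0 natr1. Qed.

(** Of the arcs 4j, 4j+1, 4j+2, 4j+3, the first two are the edges of index 2j and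
2j+1, and each of them is glued to the arc two places further. *)
Definition edge_arc (i : nat) : nat := (4 * i./2 + odd i)%N.

Lemma arc_edgeP g k : (k < 4 * g)%N ->
  exists2 i, (i < 2 * g)%N & k = edge_arc i \/ k = (edge_arc i).+2.
Proof.
by move=> kg; exists (2 * (k %/ 4) + odd k)%N; rewrite /edge_arc; lia.
Qed.

Lemma gluedP g (p q : @disc R) : glued g p q <-> exists (i : nat) (s : R),
  [/\ (i < 2 * g)%N, 0 <= s <= 1, val p = arc g (edge_arc i) s &
      val q = arc g (edge_arc i).+2 (1 - s)].
Proof.
split=> [[j [s [jg s01 [[pE qE]|[pE qE]]]]]|[i [s [ig s01 pE qE]]]].
- exists (2 * j)%N, s; have e : edge_arc (2 * j) = (4 * j)%N by rewrite /edge_arc; lia.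
  by split; rewrite ?e ?pE ?qE //; [lia|congr arc; lia].
- exists (2 * j + 1)%N, s.
  have e : edge_arc (2 * j + 1) = (4 * j + 1)%N by rewrite /edge_arc; lia.
  by split; rewrite ?e ?pE ?qE //; [lia|congr arc; lia].
exists i./2, s; split=> //; first by lia.
move: pE qE; rewrite /edge_arc; case: (odd i) => -> ->;
  by [right; split; congr arc; lia|left; split; congr arc; lia].
Qed.
End Arcs.

Section StandardSurfaces.
Variables (R : realType) (S : topologicalType).
Hypotheses (hS : hausdorff_space S) (lS : locally_planar R S).

(** Let c be the primitive on the disc.  Paired arcs have the same image, so c
varies along them in the same way ([cg]).  The integral of phi over each edge is
zero, so c takes one value at all vertices, hence equal values at paired points. *)
Lemma glued_disc_detected (C : set S) g : homeomorphic C (glued_disc R g) ->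
  exists2 es : seq (R -> S), size es = (2 * g)%N & detects C es.
Proof.
move=> [f [f' [cf cf' fK f'K]]].
pose q (p : @disc R) : S := set_val (f' (\pi_(glued_disc R g)%qT p)).
have cq : continuous q.
  apply: (cts_comp (@initial_continuous _ _ _)); apply: (cts_comp cf').
  exact: pi_continuous.
pose Q := q \o @to_disc R.
have qQ (p : @disc R) : q p = Q (val p) by rewrite /Q /= to_discK.
have cQ : continuous Q by apply: (cts_comp cq); exact: to_disc_cts.
have q_eq (p p' : @disc R) : q p = q p' <-> glue_equiv g p p'.
  split=> [/val_inj /(can_inj f'K) e|e]; first exact/eqmodP.
  by rewrite /q; congr (set_val (f' _)); apply/eqmodP.
have Cq : C `<=` range q.
  move=> y Cy; pose u : C := exist _ y (mem_set Cy).
  by exists (repr (f u)) => //; rewrite /q reprK fK.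
pose E i : R -> S := Q \o arc g (edge_arc i).
exists [seq E i | i <- iota 0 (2 * g)]; first by rewrite size_map size_iota.
move=> phi phiZ; rewrite all_map => /allP E0.
pose c k (s : R) := cone_period phi Q (arc g k s).
have cE k (s : R -> R) : continuous s ->
    period phi (fun t => Q (arc g k (s t))) = c k (s 1) - c k (s 0).
  move=> cs; apply: period_cone phiZ cQ _; apply: (cts_comp _ cs); exact: arc_cts.
have Qg i s : (i < 2 * g)%N -> 0 <= s <= 1 ->
    Q (arc g (edge_arc i) s) = Q (arc g (edge_arc i).+2 (1 - s)).
  move=> ig s01.
  pose p k s : @disc R := exist _ (arc g k s) (mem_set (arc_disc g k s)).
  rewrite -[arc g _ s]/(val (p _ s)) -[arc g _ (1 - s)]/(val (p _ (1 - s))) -!qQ.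
  by apply/q_eq/asboolP/rst_step; apply/gluedP; exists i, s.
have cg i s : (i < 2 * g)%N -> 0 <= s <= 1 ->
    c (edge_arc i) s - c (edge_arc i) 0 =
    c (edge_arc i).+2 (1 - s) - c (edge_arc i).+2 1.
  move=> ig /andP[s0 s1].
  have c1 : continuous (fun t : R => t * s) by cts.
  have c2 : continuous (fun t : R => 1 - t * s) by cts.
  have := cE (edge_arc i) _ c1; have := cE (edge_arc i).+2 _ c2.
  rewrite !mul1r !mul0r subr0 => <- <-; apply: eq_period.
  - by apply: (cts_comp cQ); apply: (cts_comp _ c1); exact: arc_cts.
  - by apply: (cts_comp cQ); apply: (cts_comp _ c2); exact: arc_cts.
  move=> t /andP[t0 t1]; apply: Qg => //; rewrite mulr_ge0 //=.
  by apply: le_trans s1; rewrite ler_piMl.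
have cedge i : (i < 2 * g)%N -> c (edge_arc i) 1 = c (edge_arc i) 0.
  move=> ig; apply/eqP; rewrite -subr_eq0.
  rewrite -[c _ 1]/(c _ (id 1)) -[c _ 0]/(c _ (id 0)) -(cE _ id (@cts_id R)).
  by apply: E0; rewrite mem_iota.
have carc k : (k < 4 * g)%N -> c k 1 = c k 0.
  move=> /arc_edgeP[i ig [->|->]]; first exact: cedge.
  have := cg i 1 ig; rewrite cedge // !subrr lexx ler01 => /(_ isT) /esym/eqP.
  by rewrite subr_eq0 => /eqP.
have cvertex k : (k <= 4 * g)%N -> c k 0 = c 0%N 0.
  elim: k => // k IH kg; rewrite -[LHS]/(cone_period _ _ _) -arc_next -[LHS]/(c k 1).
  by rewrite carc // IH // ltnW.
apply: (has_primitive_sub Cq); apply: (disc_image_primitive hS lS phiZ cq).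
move=> p p' pd p'd; rewrite -/Q => pp'.
pose dp : @disc R := exist _ p (mem_set pd).
pose dp' : @disc R := exist _ p' (mem_set p'd).
suff : forall a b : @disc R, clos_refl_sym_trans (@disc R) (glued g) a b ->
    cone_period phi Q (val a) = cone_period phi Q (val b).
  by move=> /(_ dp dp'); apply; apply/asboolP/q_eq; rewrite !qQ.
move=> a b; elim=> [{}a {}b|//|{}a {}b _ ->//|{}a {}b d _ -> _ ->//].
move=> /gluedP[i [s [ig s01 -> ->]]]; rewrite -/(c _ s) -/(c _ (1 - s)).
have := cg i s ig s01; rewrite carc; last by rewrite /edge_arc; lia.
rewrite (cvertex (edge_arc i)); last by rewrite /edge_arc; lia.
by rewrite (cvertex (edge_arc i).+2) => [/addIr //|]; rewrite /edge_arc; lia.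
Qed.

(** * The sphere *)

(** The disc wrapped around the sphere, with the origin going to the south pole
and the boundary circle to the north pole.  This parametrization by the square of
the radius is algebraic, and smooth at the origin. *)
Definition wrap (p : R * R) : 'rV[R]_3 :=
  let n := p.1 ^+ 2 + p.2 ^+ 2 in let w := 2 * Num.sqrt (1 - n) in
  \row_(i < 3) nth 0 [:: w * p.1; w * p.2; 2 * n - 1] i.

Lemma wrap_in p : disc p -> sphere (wrap p).
Proof.
rewrite /disc /sphere /= => pd.
rewrite !big_ord_recr big_ord0 /= !mxE /= !exprMn sqr_sqrtr ?subr_ge0 //; ring.
Qed.

Lemma wrap_cts : continuous wrap.
Proof.
apply: cts_row => j.
pose F (p : R * R) := nth 0 [:: 2 * Num.sqrt (1 - (p.1 ^+ 2 + p.2 ^+ 2)) * p.1;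
   2 * Num.sqrt (1 - (p.1 ^+ 2 + p.2 ^+ 2)) * p.2; 2 * (p.1 ^+ 2 + p.2 ^+ 2) - 1] j.
suff : continuous F.
  suff -> : F = fun p => wrap p 0 j by [].
  by apply/funext => p; rewrite mxE.
by rewrite /F; case: j {F} => [[|[|[|//]]] ?] /=; cts.
Qed.

Lemma wrap_onto v : sphere v -> exists2 p : R * R, disc p & wrap p = v.
Proof.
rewrite /sphere /= !big_ord_recr big_ord0 /= add0r.
set a := v 0 _; set b := v 0 _; set c := v 0 _ => abc.
have vE p : wrap p 0 ord0 = a -> wrap p 0 (fintype.lift ord0 ord0) = b ->
    wrap p 0 ord_max = c -> wrap p = v.
  move=> pa pb pc; apply/rowP => j.
  case: j => [[|[|[|//]]] Hj].
  - have -> : Ordinal Hj = ord0 by apply: val_inj.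
    by rewrite pa; congr (v _ _); apply: val_inj.
  - have -> : Ordinal Hj = fintype.lift ord0 ord0 by apply: val_inj.
    by rewrite pb; congr (v _ _); apply: val_inj.
  - have -> : Ordinal Hj = ord_max by apply: val_inj.
    by rewrite pc; congr (v _ _); apply: val_inj.
have c1 : -1 <= c <= 1 by apply/andP; split; nra.
have [cE|cN] := eqVneq c 1.
  have [a0 b0] : a = 0 /\ b = 0 by split; nra.
  exists (1, 0); first by rewrite /disc /= expr1n expr0n addr0.
  apply: vE; rewrite mxE /= expr1n expr0n /= addr0 ?subrr ?sqrtr0; lra.
pose w := 2 * Num.sqrt ((1 - c) / 2).
have w0 : 0 < w by rewrite mulr_gt0 // sqrtr_gt0; lra.
have w2 : w ^+ 2 = 2 * (1 - c) by rewrite exprMn sqr_sqrtr; lra.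
have n : (a / w) ^+ 2 + (b / w) ^+ 2 = (1 + c) / 2.
  rewrite !expr_div_n -mulrDl w2; have -> : a ^+ 2 + b ^+ 2 = (1 - c) * (1 + c) by nra.
  by field; lra.
have n' : 1 - (1 + c) / 2 = (1 - c) / 2 by field.
exists (a / w, b / w); first by rewrite /disc /= n; lra.
apply: vE; rewrite mxE /= n; last by field.
  by rewrite n' -/w mulrC divfK ?gt_eqF.
by rewrite n' -/w mulrC divfK ?gt_eqF.
Qed.

Lemma wrap_inj p p' : disc p -> disc p' -> wrap p = wrap p' ->
  p = p' \/ p.1 ^+ 2 + p.2 ^+ 2 = 1 /\ p'.1 ^+ 2 + p'.2 ^+ 2 = 1.
Proof.
rewrite /disc /= => pd p'd e.
have := congr1 (fun v : 'rV[R]_3 => v 0 ord_max) e; rewrite !mxE /= => e3.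
have := congr1 (fun v : 'rV[R]_3 => v 0 (fintype.lift ord0 ord0)) e.
rewrite !mxE /= => e2.
have := congr1 (fun v : 'rV[R]_3 => v 0 ord0) e; rewrite !mxE /= => e1.
have n : p.1 ^+ 2 + p.2 ^+ 2 = p'.1 ^+ 2 + p'.2 ^+ 2 by lra.
rewrite -!n in e1 e2 *.
have [->|n1] := eqVneq (p.1 ^+ 2 + p.2 ^+ 2) 1; [by right|left].
have w0 : 2 * Num.sqrt (1 - (p.1 ^+ 2 + p.2 ^+ 2)) != 0.
  by rewrite mulf_neq0 ?pnatr_eq0 // gt_eqF // sqrtr_gt0 subr_gt0 lt_neqAle n1.
by case: p p' e1 e2 {e e3 n n1 pd p'd} w0 => [x y] [x' y'] /= e1 e2 w0;
  rewrite (mulfI w0 e1) (mulfI w0 e2).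
Qed.

Lemma circle_angle (p : R * R) : p.1 ^+ 2 + p.2 ^+ 2 = 1 ->
  exists t : R, p = (cos t, sin t).
Proof.
case: p => x y /= xy1.
have x1 : -1 <= x <= 1 by apply/andP; split; nra.
have ca : cos (acos x) = x by apply: acosK; rewrite in_itv.
have sa := sin_acos x1.
have e : 1 - x ^+ 2 = y ^+ 2 by lra.
rewrite e sqrtr_sqr in sa.
have [y0|y0] := leP 0 y.
  by exists (acos x); rewrite ca sa ger0_norm.
by exists (- acos x); rewrite cosN sinN ca sa ltr0_norm // opprK.
Qed.

(** The primitive on the disc is constant on the boundary circle, because the
circle is mapped to a point; elsewhere the disc is embedded in the sphere. *)
Lemma sphere_detected (C : set S) : homeomorphic C (@sphere R) -> @detects R S C [::].
Proof.
move=> [f [f' [cf cf' fK f'K]]] phi phiZ _.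
pose wr (p : @disc R) : @sphere R :=
  exist _ (wrap (val p)) (mem_set (wrap_in (set_valP p))).
pose q (p : @disc R) : S := set_val (f' (wr p)).
have cq : continuous q.
  apply: (cts_comp (@initial_continuous _ _ _)); apply: (cts_comp cf').
  apply: continuous_comp_initial; apply: (cts_comp wrap_cts).
  exact: initial_continuous.
pose Q := q \o @to_disc R.
have cQ : continuous Q by apply: (cts_comp cq); exact: to_disc_cts.
have Qw p p' : disc p -> disc p' -> Q p = Q p' <-> wrap p = wrap p'.
  move=> pd p'd; rewrite -{2}(disc_retract_id pd) -{2}(disc_retract_id p'd).
  split=> [/val_inj /(can_inj f'K) /(congr1 val) //|e].
  by rewrite /Q /q /=; congr (set_val (f' _)); apply: val_inj.
have Cq : C `<=` range q.
  move=> y Cy; pose u : C := exist _ y (mem_set Cy).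
  have [p pd pE] := wrap_onto (set_valP (f u)).
  exists (exist _ p (mem_set pd)) => //.
  rewrite /q; have -> : wr (exist _ p (mem_set pd)) = f u by apply: val_inj.
  by rewrite fK.
apply: (has_primitive_sub Cq); apply: (disc_image_primitive hS lS phiZ cq).
move=> p p' pd p'd; rewrite -/Q.
move=> /(Qw _ _ pd p'd) /(wrap_inj pd p'd) [-> //|[p1 p'1]].
suff bd : forall a : R * R, a.1 ^+ 2 + a.2 ^+ 2 = 1 ->
  cone_period phi Q a = cone_period phi Q (1, 0) by rewrite !bd.
move=> a /circle_angle[t ->].
pose gam (s : R) := (cos (s * t), sin (s * t)).
have cgam : continuous gam by rewrite /gam; cts.
have gd s : disc (gam s) by rewrite /disc /= cos2Dsin2.
have := @period_cone _ _ phi Q gam phiZ cQ cgam.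
have -> : (fun s => Q (gam s)) = fun=> Q (1, 0).
  apply/funext => s; apply/Qw => //; first by rewrite /disc /= expr1n expr0n addr0.
  apply/rowP => j; rewrite !mxE /= cos2Dsin2 expr1n expr0n /= addr0.
  by rewrite subrr sqrtr0 mulr0 !mul0r.
rewrite period_cst // /gam mul1r mul0r cos0 sin0 => /esym/eqP.
by rewrite subr_eq0 => /eqP.
Qed.

Lemma standard_surface_detected (C : set S) g :
  homeomorphic C (standard_surface R g) ->
  exists2 es : seq (R -> S), size es = (2 * g)%N & detects C es.
Proof.
case: g => [|g] hC; last exact: glued_disc_detected.
by exists [::] => //; exact: sphere_detected.
Qed.
End StandardSurfaces.

(** * Disconnected surfaces *)

Lemma all_flatten (T : Type) (a : pred T) (ss : seq (seq T)) :
  all a (flatten ss) = all (all a) ss.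
Proof. by elim: ss => //= s ss <-; rewrite all_cat. Qed.

Section Components.
Variables (R : realType) (S : topologicalType).

Lemma path_in_component (gamma : R -> S) t : continuous gamma ->
  connected_component [set: S] (gamma 0) (gamma t).
Proof.
move=> cg; apply: (@connected_component_max _ _ (range gamma)) => //.
apply: connected_continuous_connected.
  by apply/connected_intervalP => x y _ _ z _.
exact/continuous_subspaceT.
Qed.

(** Every path stays in one component, so primitives on the components add up to
a 0-cochain, however they are chosen. *)
Lemma surface_detected g :
  hausdorff_space S -> locally_planar R S -> has_genus R S g ->
  exists2 es : seq (R -> S), size es = (2 * g)%N &
    forall phi : cochain R S 1, phi \in cocycles R S 1 ->
      all (fun e => period phi e == 0) es -> phi \in coboundaries R S 1.
Proof.
move=> hS lS [gm [fin hom gE]].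
have /choice[es esP] : forall C : set S, exists es : seq (R -> S),
    components C -> size es = (2 * gm C)%N /\ detects C es.
  move=> C; have [CS|nC] := pselect (components C); last by exists [::] => /nC.
  by have [es e1 e2] := standard_surface_detected hS lS (hom C CS); exists es.
have finE (C : set S) : C \in fset_set (@components S) -> components C.
  by rewrite in_fset_set // => /set_mem.
exists (flatten [seq es C | C <- fset_set (@components S)]).
  rewrite size_flatten /shape -map_comp gE fsbig_finite // sumnE big_map big_distrr /=.
  by apply: eq_big_seq => C /finE /esP[].
move=> phi phiZ; rewrite all_flatten all_map => /allP phi0.
have /choice[h hP] : forall C : set S, exists h : S -> int, components C ->
    forall gamma : R -> S, continuous gamma ->
    (forall t, C (gamma t)) -> period phi gamma = h (gamma 1) - h (gamma 0).
  move=> C; have [CS|nC] := pselect (components C); last by exists (fun=> 0) => /nC.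
  have [_ det] := esP _ CS.
  have CA : C \in fset_set (@components S) by rewrite in_fset_set // mem_set.
  by have [h hP] := det _ phiZ (phi0 C CA); exists h.
apply/asboolP; pose pt := vertex_point R.
exists (fun s => h (connected_component [set: S] (s pt)) (s pt)).
apply/funext => s; rewrite coboundary_vertexE -period_path_of /=.
have cs := @path_of_cts _ _ s.
have cmp t := path_in_component t cs.
rewrite -(same_connected_component (cmp 1)).
by apply: hP => //; exists (path_of s 0).
Qed.
End Components.

(** * Naturality of the cap product *)

Section Pullback.
Variables (R : realType) (S X : topologicalType) (f : continuousType S X).

Definition pull n (phi : cochain R X n) : cochain R S n :=
  fun s => phi (f \o s : simplex R X n).

Lemma pull_cocycle n (phi : cochain R X n) :
  phi \in cocycles R X n -> pull phi \in cocycles R S n.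
Proof.
move=> /eqP phi0; apply/eqP/funext => s.
rewrite -[RHS](congr1 (fun F => F (f \o s : simplex R X n.+1)) phi0).
by apply: eq_bigr => i _; congr (_ * phi _); apply/continuousEP.
Qed.

Lemma cap_push n k l (c : chain R S n) (phi : cochain R X k) :
  cap_chain l (push_chain f c) phi = push_chain f (cap_chain l c (pull phi)).
Proof.
pose F (c : chain R S n) := cap_chain l (push_chain f c) phi.
pose G (c : chain R S n) := push_chain f (cap_chain l c (pull phi)).
apply: (@chain_additive_eq _ _ F G) => [a b|a b|s]; rewrite /F /G.
- by rewrite raddfB cap_chainBl.
- by rewrite cap_chainBl raddfB.
- rewrite push_chainU !cap_chainU push_chainU; congr << _ * phi _ *g _ >>.
  all: exact/continuousEP.
Qed.

Lemma period_pullB (e : R -> S) :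
  zmod_morphism (fun phi : cochain R X 1 => period (pull phi) e).
Proof. by move=> phi psi; rewrite /period; case: pselect => // _; rewrite subr0. Qed.
End Pullback.

Section SubquotientClasses.
Variables (V : zmodType) (Z B : zmodClosed V) (x y : V) (xZ : x \in Z) (yZ : y \in Z).

Lemma subquot_classB (xyZ : x - y \in Z) :
  subquot_class Z B xyZ = subquot_class Z B xZ - subquot_class Z B yZ.
Proof.
rewrite /subquot_class; set a := exist _ x xZ; set b := exist _ y yZ.
rewrite -[RHS](raddfB (\pi_(Quotient.quot (@in_denom _ Z B)))%qT
  (a : subgrp Z) (b : subgrp Z)).
congr (\pi%qT _); exact: val_inj.
Qed.
End SubquotientClasses.

Lemma subquot_class_eq0 (V : zmodType) (Z B : zmodClosed V) (x : V) (xZ : x \in Z) :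
  x \in B -> subquot_class Z B xZ = 0.
Proof.
move=> xB; have xxZ : x - x \in Z by exact: rpredB.
rewrite -(subrr (subquot_class Z B xZ)) -(subquot_classB B xZ xZ xxZ).
by apply/subquot_class_eq; rewrite subrr subr0.
Qed.

Section CapCocycle.
Variables (R : realType) (X : topologicalType) (k l : nat).

(** The cap product as a function of cocycles rather than of their classes:
cocycles, unlike classes, have periods along open paths. *)
Definition cap_cocycle (alpha : homology R X (k + l))
    (sigma : subgrp (cocycles R X k)) : homology R X l :=
  subquot_class (cycles R X l) (boundaries R X l)
    (cap_cycles (erefl (k + l)%N) (subquot_rep_in alpha) (valP sigma)).

Lemma cap_cocycleB alpha : zmod_morphism (cap_cocycle alpha).
Proof.
move=> s t; rewrite /cap_cocycle -subquot_classB; last first.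
  by move=> ?; apply/subquot_class_eq; rewrite GRing.valB cap_chainBr subrr rpred0.
by rewrite rpredB //; apply: cap_cycles => //; exact: subquot_rep_in || exact: valP.
Qed.

Lemma cap_cocycle_eq0 (S : topologicalType) (f : continuousType S X)
    (mu : homology R S (k + l)) (sigma : subgrp (cocycles R X k)) :
  pull f (val sigma) \in coboundaries R S k -> cap_cocycle (push f mu) sigma = 0.
Proof.
move=> cob; apply: subquot_class_eq0.
set m := subquot_rep mu; have mZ : m \in cycles R S (k + l) by exact: subquot_rep_in.
rewrite -(subrK (cap_chain l (push_chain f m) (val sigma)) (cap_chain _ _ _)).
rewrite -cap_chainBl; apply: rpredD.
  apply: cap_boundaries (valP sigma) => //; exact: subquot_rep_class.
rewrite cap_push.
have /asboolP[e ->] := @cap_coboundaries R S k l _ m _ erefl mZ cob.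
by apply/asboolP; exists (push_chain f e); exact: push_boundary.
Qed.
End CapCocycle.

(** * The rank estimate *)

(** A rational relation exists for reasons of dimension; clear denominators. *)
Lemma int_relation m k (A : 'I_k -> 'I_m -> int) : (m < k)%N ->
  exists c : 'I_k -> int, (exists i, c i != 0) /\ forall j, \sum_i A i j *~ c i = 0.
Proof.
move=> mk; pose M : 'M[rat]_(k, m) := \matrix_(i, j) (A i j)%:~R.
have : kermx M != 0.
  rewrite -mxrank_eq0 mxrank_ker subn_eq0 -ltnNge.
  exact: leq_ltn_trans (rank_leq_col M) mk.
move=> /rowV0Pn[v /sub_kermxP vM v0].
pose c i := numq (v 0 i) * \prod_(j | j != i) denq (v 0 j).
pose D : int := \prod_j denq (v 0 j).
have cE i : (c i)%:~R = v 0 i * D%:~R.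
  rewrite /D (bigD1 i) //= /c !rmorphM /= mulrA; congr (_ * _).
  by rewrite -{2}[v 0 i]divq_num_den divfK // intr_eq0 denq_eq0.
have D0 : (D%:~R : rat) != 0.
  by rewrite intr_eq0; apply/prodf_neq0 => j _; exact: denq_neq0.
exists c; split.
  have [i vi] : exists i, v 0 i != 0 by apply/rV0Pn.
  by exists i; rewrite -(intr_eq0 rat) cE mulf_neq0.
move=> j; apply/eqP; rewrite -(intr_eq0 rat) rmorph_sum /=.
have := congr1 (fun w : 'rV[rat]_m => w 0 j * D%:~R) vM.
rewrite !mxE mul0r mulr_suml => vj.
rewrite -[X in _ == X]vj; apply/eqP/eq_bigr => i _.
by rewrite mulrzz intrM mxE cE mulrA [_ * v 0 i]mulrC.
Qed.

Lemma zmod_morphism_combination (U V : zmodType) (F : U -> V) k (u : 'I_k -> U)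
  (c : 'I_k -> int) :
  zmod_morphism F -> F (\sum_i u i *~ c i) = \sum_i F (u i) *~ c i.
Proof.
move=> FB; pose F' := GRing.isZmodMorphism.Build _ _ F FB.
pose HF : {additive U -> V} := HB.pack F F'.
rewrite -[F]/(HF : _ -> _) raddf_sum; apply: eq_bigr => i _; exact: raddfMz.
Qed.

Theorem proposition3p1 (R : realType) (X : topologicalType)
    (alpha : homology R X 2) :
  (2%:E * gen alpha >= zrank R (range (@cap R X 1 1 alpha)))%E.
Proof.
rewrite -lee_pdivrMl //; apply: le_ereal_inf_tmp.
move=> _ [g [S [mu [f [[hS _ lS] _ fmu gS]]]] <-].
rewrite lee_pdivrMl //; apply: ge_ereal_sup => _ [k [v vcap vfree] <-].
rewrite -EFinM lee_fin -natrM ler_nat leqNgt; apply/negP => kg.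
have [es esE det] := surface_detected hS lS gS.
have /choice[b bE] : forall i, exists b, @cap R X 1 1 alpha b = v i.
  by move=> i; have [b _ <-] := vcap i; exists b.
pose sigma i : subgrp (cocycles R X 1) :=
  exist _ (subquot_rep (b i)) (subquot_rep_in (b i)).
have vE i : v i = @cap_cocycle R X 1 1 alpha (sigma i).
  by rewrite -bE; apply/subquot_class_eq; rewrite subrr rpred0.
pose A i j := period (pull f (val (sigma i))) (tnth (in_tuple es) j).
have [|c [[i ci0] cA]] := @int_relation (size es) k A; first by rewrite esE.
have c0 : forall i, c i = 0.
  apply: vfree; under eq_bigr do rewrite vE.
  rewrite -(zmod_morphism_combination _ _ (@cap_cocycleB R X 1 1 alpha)) -fmu.
  apply: (@cap_cocycle_eq0 R X 1 1 S f); apply: det; first exact/pull_cocycle/valP.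
  apply/(@all_tnthP _ _ _ (in_tuple es)) => j.
  have FB : zmod_morphism (fun s : subgrp (cocycles R X 1) =>
      period (pull f (val s)) (tnth (in_tuple es) j)).
    by move=> s t; rewrite GRing.valB period_pullB.
  by rewrite (zmod_morphism_combination sigma c FB) -[X in _ == X](cA j).
by move: ci0; rewrite c0 eqxx.
Qed.
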